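(* Let $\mathbbm{k}$ be a field. (1) Let $S$ be a Frobenius Poisson algebra over $\mathbbm{k}$ with non-degenerate bilinear form $\langle-,-\rangle: S\otimes S\to\mathbbm{k}$. For $P\in\mathfrak{X}^m(S)$ $(m\ge 1)$, let $\Delta(P)\in\mathfrak{X}^{m-1}(S)$ be defined by $$\langle\Delta(P)(a_1,\dots,a_{m-1}),a_m\rangle=(-1)^{m-1}\langle P(a_1,\dots,a_{m-1},a_m),1\rangle\qquad (a_1,\dots,a_m\in S),$$ and $\Delta=0$ on $\mathfrak{X}^0(S)$. Then $(\mathfrak{X}(S),\wedge,\Delta)$ is a Batalin-Vilkovisky algebra. (2) If, moreover, $S$ is unimodular, then $(\mathrm{HP}(S),\wedge,\Delta)$, with the operations induced by $\wedge$ and $\Delta$ on Poisson cohomology, is a Batalin-Vilkovisky algebra.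
   Context: A Poisson algebra is a commutative $\mathbbm{k}$-algebra $S$ with a bilinear Lie bracket $\{-,-\}: S\otimes S\to S$ that is a derivation in each variable. It is a Frobenius Poisson algebra if $S$ is Frobenius as an associative algebra: there is an isomorphism of $S$-modules $\sigma:S\to S^*$ ($\mathbbm{k}$-linear dual); the associated non-degenerate bilinear form is $\langle a,b\rangle:=\sigma(b)(a)$, satisfying $\langle ab,c\rangle=\langle a,bc\rangle$. $\mathfrak{X}^k(S)$ is the space of all $\mathbbm{k}$-linear maps $S^{\otimes k}\to S$ that are derivations in each argument and skew-symmetric, i.e. $f(a_1,\dots,a_k)=\varepsilon(\theta)f(a_{\theta_1},\dots,a_{\theta_k})$ for all permutations $\theta$ ($\varepsilon$ = sign, $\theta_i=\theta(i)$); $\mathfrak{X}^0(S)=S$; $\mathfrak{X}(S)=\bigoplus_k\mathfrak{X}^k(S)$. For $P\in\mathfrak{X}^m(S)$, $Q\in\mathfrak{X}^n(S)$, $$(P\wedge Q)(a_1,\dots,a_{m+n})=\sum_{\theta\in S_{m,n}}\varepsilon(\theta)P(a_{\theta_1},\dots,a_{\theta_m})Q(a_{\theta_{m+1}},\dots,a_{\theta_{m+n}}),$$ where $S_{m,n}$ is the set of permutations of $\{1,\dots,m+n\}$ with $\theta_1<\dots<\theta_m$ and $\theta_{m+1}<\dots<\theta_{m+n}$. Poisson cohomology $\mathrm{HP}^\bullet(S)$ is the cohomology of $(\mathfrak{X}^\bullet(S),\delta_\bullet)$ with $$\delta_k(P)(y_0,\dots,y_k)=\sum_{0\le i\le k}(-1)^i\{y_i,P(y_0,\dots,\widehat{y_i},\dots,y_k)\}+\sum_{0\le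 i<j\le k}(-1)^{i+j}P(\{y_i,y_j\},y_0,\dots,\widehat{y_i},\dots,\widehat{y_j},\dots,y_k).$$ $\mathrm{HP}(S)=\bigoplus_k\mathrm{HP}^k(S)$ is a graded commutative ring under the product induced by $\wedge$. Let $\pi\in\mathfrak{X}^2(S)$, $\pi(a,b)=\{a,b\}$. The Frobenius Poisson algebra $S$ (with its form and the associated $\Delta$) is unimodular if $\Delta(\pi)=0$. A Gerstenhaber algebra $(A^\bullet,\wedge,[\,,\,])$ is a $\mathbb{Z}$-graded commutative algebra $(A,\wedge)$ with a bracket of degree $-1$ that makes the shifted space $A^{\bullet+1}$ a graded Lie algebra (graded antisymmetry $[a,b]=-(-1)^{(m-1)(n-1)}[b,a]$ and graded Jacobi) and satisfies $[a\wedge b,c]=[a,c]\wedge b+(-1)^{m(p-1)}a\wedge[b,c]$ for $a\in A^m$, $b\in A^n$, $c\in A^p$. A Batalin-Vilkovisky algebra is a triple $(A^\bullet,\wedge,\Delta)$ with $(A,\wedge)$ a $\mathbb{Z}$-graded commutative algebra and $\Delta:A\to A$ of degree $-1$ with $\Delta^2=0$, such that the bracket defined for $a\in A^m$, $b\in A^n$ by $$-(-1)^{(m-1)n}[a,b]:=\Delta(a\wedge b)-\Delta(a)\wedge b-(-1)^m a\wedge\Delta(b)+(-1)^m a\wedge\Delta(1)\wedge b$$ makes $(A^\bullet,\wedge,[\,,\,])$ a Gerstenhaber algebra ($1\in A^0$ the identity). *)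

(* Defs.v *)
From HB Require Import structures.
From mathcomp Require Import all_boot all_order all_algebra perm.
From mathcomp Require Import mathcomp_extra boolp classical_sets functions.
From mathcomp Require Import cardinality fsbigop.

Set Implicit Arguments.
Unset Strict Implicit.
Unset Printing Implicit Defensive.

Import GRing.Theory.
Local Open Scope classical_set_scope.
Local Open Scope quotient_scope.
Local Open Scope ring_scope.

Definition famprod (R : pzRingType) (A : nat -> lmodType R) := forall n, A n.

Section FamProd.
Variables (R : pzRingType) (A : nat -> lmodType R).
Implicit Types x y z : famprod A.

HB.instance Definition _ := gen_eqMixin (famprod A).
HB.instance Definition _ := gen_choiceMixin (famprod A).

Let fam_add x y : famprod A := fun n => x n + y n.
Let fam_opp x : famprod A := fun n => - x n.
Let fam_zero : famprod A := fun n => 0.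
Let fam_scale (c : R) x : famprod A := fun n => c *: x n.

Fact fam_addA : associative fam_add.
Proof. by move=> x y z; apply: functional_extensionality_dep => n; apply: addrA. Qed.
Fact fam_addC : commutative fam_add.
Proof. by move=> x y; apply: functional_extensionality_dep => n; apply: addrC. Qed.
Fact fam_add0 : left_id fam_zero fam_add.
Proof. by move=> x; apply: functional_extensionality_dep => n; apply: add0r. Qed.
Fact fam_addN : left_inverse fam_zero fam_opp fam_add.
Proof. by move=> x; apply: functional_extensionality_dep => n; apply: addNr. Qed.

HB.instance Definition _ :=
  GRing.isZmodule.Build (famprod A) fam_addA fam_addC fam_add0 fam_addN.

Fact fam_scaleA a b x : fam_scale a (fam_scale b x) = fam_scale (a * b) x.
Proof. by apply: functional_extensionality_dep => n; apply: scalerA. Qed.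
Fact fam_scale1 : left_id 1 fam_scale.
Proof. by move=> x; apply: functional_extensionality_dep => n; apply: scale1r. Qed.
Fact fam_scaleDr : right_distributive fam_scale +%R.
Proof.
by move=> c x y; apply: functional_extensionality_dep => n; apply: scalerDr.
Qed.
Fact fam_scaleDl x : {morph fam_scale^~ x : a b / a + b}.
Proof. by move=> a b; apply: functional_extensionality_dep => n; apply: scalerDl. Qed.

HB.instance Definition _ := GRing.Zmodule_isLmodule.Build R (famprod A)
  fam_scaleA fam_scale1 fam_scaleDr fam_scaleDl.

Definition dsum_pred : {pred famprod A} :=
  fun x => `[< exists N, forall n, (N <= n)%N -> x n = 0 >].

Fact dsum_closed : subsemimod_closed dsum_pred.
Proof.
split; first split.
- by apply/asboolP; exists 0%N.
- move=> x y /asboolP[N hN] /asboolP[M hM]; apply/asboolP.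
  exists (maxn N M) => n; rewrite geq_max => /andP[nN nM].
  have -> : (x + y : famprod A) n = x n + y n by [].
  by rewrite hN// hM// add0r.
- move=> c x /asboolP[N hN]; apply/asboolP; exists N => n nN.
  have -> : (c *: x : famprod A) n = c *: x n by [].
  by rewrite hN// scaler0.
Qed.

HB.instance Definition _ :=
  GRing.isSubmodClosed.Build R (famprod A) dsum_pred dsum_closed.

Record dsum := DSum {dsum_fam : famprod A; _ : dsum_fam \in dsum_pred}.

HB.instance Definition _ := [isSub for dsum_fam].
HB.instance Definition _ := [Choice of dsum by <:].
HB.instance Definition _ := [SubChoice_isSubLmodule of dsum by <:].

Definition dcomp (x : dsum) (n : nat) : A n := dsum_fam x n.

Fact dinj_subproof n (a : A n) :
  (@eqtype.dfwith _ (fun m => A m) (fun m => 0) n a : famprod A) \in dsum_pred.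
Proof.
apply/asboolP; exists n.+1 => m nm.
by rewrite eqtype.dfwith_out// neq_ltn nm.
Qed.

Definition dinj n (a : A n) : dsum := DSum (dinj_subproof a).

(* The grading is by int; the pieces of negative degree are zero. *)
Definition dgrade (z : int) (x : dsum) : Prop :=
  forall n : nat, n%:Z != z -> dcomp x n = 0.

End FamProd.

Section QuotientLmodule.
Variables (R : pzRingType) (V : lmodType R) (W : submodClosed V).

Definition lquot_pred : {pred V} := fun v => v \in W.

Fact lquot_zmod_closed : zmod_closed lquot_pred.
Proof.
split; first exact: rpred0.
by move=> v w vW wW; apply: rpredD => //; rewrite -scaleN1r; apply: rpredZ.
Qed.

HB.instance Definition _ := GRing.isZmodClosed.Build V lquot_pred lquot_zmod_closed.

Definition lquot : Type := Quotient.quot lquot_pred.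
HB.instance Definition _ := GRing.Zmodule.on lquot.

Definition lpi (v : V) : lquot := \pi_(Quotient.quot lquot_pred) v.

Fact lpiP v w : lpi v = lpi w <-> v - w \in W.
Proof.
rewrite -[v - w \in W]/(v - w \in lquot_pred) Quotient.idealrBE.
by split=> /eqP.
Qed.

Fact lpi_repr x : exists v, x = lpi v.
Proof. by exists (repr (x : Quotient.quot lquot_pred)); rewrite /lpi reprK. Qed.

Fact lpiD v w : lpi (v + w) = lpi v + lpi w.
Proof. by rewrite /lpi raddfD. Qed.

Definition lquot_scale (c : R) (x : lquot) : lquot :=
  lpi (c *: repr (x : Quotient.quot lquot_pred)).

Fact lpiZ c v : lpi (c *: v) = lquot_scale c (lpi v).
Proof.
apply/lpiP; rewrite -scalerBr; apply: rpredZ; apply/lpiP.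
by rewrite /lpi reprK.
Qed.

Fact lquot_scaleA a b x : lquot_scale a (lquot_scale b x) = lquot_scale (a * b) x.
Proof. by have [v ->] := lpi_repr x; rewrite -!lpiZ scalerA. Qed.
Fact lquot_scale1 : left_id 1 lquot_scale.
Proof. by move=> x; have [v ->] := lpi_repr x; rewrite -!lpiZ scale1r. Qed.
Fact lquot_scaleDr : right_distributive lquot_scale +%R.
Proof.
move=> c x y; have [v ->] := lpi_repr x; have [w ->] := lpi_repr y.
by rewrite -lpiD -!lpiZ scalerDr lpiD.
Qed.
Fact lquot_scaleDl x : {morph lquot_scale^~ x : a b / a + b}.
Proof.
by move=> a b; have [v ->] := lpi_repr x; rewrite -!lpiZ scalerDl lpiD.
Qed.

HB.instance Definition _ := GRing.Zmodule_isLmodule.Build R lquot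
  lquot_scaleA lquot_scale1 lquot_scaleDr lquot_scaleDl.

End QuotientLmodule.
Section GradedAlgebras.
Variables (K : fieldType) (A : lmodType K).

Definition bilinear_op (mul : A -> A -> A) : Prop :=
  (forall c x y z, mul (c *: x + y) z = c *: mul x z + mul y z) /\
  (forall c x y z, mul z (c *: x + y) = c *: mul z x + mul z y).

(* gr n is the homogeneous component A^n, and A is the direct sum of the A^n. *)
Record is_grading (gr : int -> A -> Prop) : Prop := {
  gr_zero : forall n, gr n 0;
  gr_lin : forall n c x y, gr n x -> gr n y -> gr n (c *: x + y);
  gr_span : forall x, exists (s : seq int) (f : int -> A),
    (forall n, gr n (f n)) /\ x = \sum_(n <- s) f n;
  gr_direct : forall (s : seq int) (f : int -> A), uniq s ->
    (forall n, gr n (f n)) -> \sum_(n <- s) f n = 0 ->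
    forall n, n \in s -> f n = 0
}.

Record is_graded_comm_algebra (gr : int -> A -> Prop) (mul : A -> A -> A)
    (one : A) : Prop := {
  gca_grading : is_grading gr;
  gca_bilinear : bilinear_op mul;
  gca_assoc : associative mul;
  gca_one_mul : left_id one mul;
  gca_mul_one : right_id one mul;
  gca_one_gr : gr 0 one;
  gca_mul_gr : forall m n a b, gr m a -> gr n b -> gr (m + n) (mul a b);
  gca_comm : forall m n a b, gr m a -> gr n b ->
    mul a b = (-1) ^ (m * n) *: mul b a
}.

Record is_Gerstenhaber (gr : int -> A -> Prop) (mul : A -> A -> A) (one : A)
    (br : A -> A -> A) : Prop := {
  ger_gca : is_graded_comm_algebra gr mul one;
  ger_bilinear : bilinear_op br;
  ger_gr : forall m n a b, gr m a -> gr n b -> gr (m + n - 1) (br a b);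
  ger_anti : forall m n a b, gr m a -> gr n b ->
    br a b = - ((-1) ^ ((m - 1) * (n - 1)) *: br b a);
  ger_jacobi : forall m n p a b c, gr m a -> gr n b -> gr p c ->
    br a (br b c) =
      br (br a b) c + (-1) ^ ((m - 1) * (n - 1)) *: br b (br a c);
  ger_leibniz : forall m n p a b c, gr m a -> gr n b -> gr p c ->
    br (mul a b) c = mul (br a c) b + (-1) ^ (m * (p - 1)) *: mul a (br b c)
}.

Record is_BV (gr : int -> A -> Prop) (mul : A -> A -> A) (one : A)
    (D : A -> A) : Prop := {
  bv_gca : is_graded_comm_algebra gr mul one;
  bv_linear : forall c x y, D (c *: x + y) = c *: D x + D y;
  bv_gr : forall m a, gr m a -> gr (m - 1) (D a);
  bv_square : forall a, D (D a) = 0;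
  bv_bracket : exists br : A -> A -> A,
    (forall m n a b, gr m a -> gr n b ->
      - ((-1) ^ ((m - 1) * n) *: br a b) =
        D (mul a b) - mul (D a) b - (-1) ^ m *: mul a (D b)
        + (-1) ^ m *: mul (mul a (D one)) b) /\
    is_Gerstenhaber gr mul one br
}.

End GradedAlgebras.

Section Multiderivations.
Variables (K : fieldType) (S : comAlgType K).

(* A linear map on the n-th tensor power is represented by the corresponding
   multilinear map on 'I_n -> S; in particular multider 0 is a copy of S. *)
Definition upd n (a : 'I_n -> S) (i : 'I_n) (x : S) : 'I_n -> S :=
  fun j => if j == i then x else a j.

Record is_multider n (P : ('I_n -> S) -> S) : Prop := {
  md_lin : forall a i (c : K) x y,
    P (upd a i (c *: x + y)) = c *: P (upd a i x) + P (upd a i y);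
  md_der : forall a i x y,
    P (upd a i (x * y)) = x * P (upd a i y) + P (upd a i x) * y;
  md_skew : forall (t : 'S_n) a, P a = (-1) ^+ t * P (a \o t)
}.

Definition multider_pred n : {pred ('I_n -> S) -> S} := fun P => `[< is_multider P >].

Fact multider_closed n : subsemimod_closed (@multider_pred n).
Proof.
split; first split.
- apply/asboolP; split=> *; first by rewrite /= scaler0 addr0.
    by rewrite /= mulr0 mul0r addr0.
  by rewrite /= mulr0.
- move=> P Q /asboolP[P1 P2 P3] /asboolP[Q1 Q2 Q3]; apply/asboolP; split.
  + move=> a i c x y; have E b : (P + Q) b = P b + Q b by [].
    by rewrite !E P1 Q1 scalerDr addrACA.
  + move=> a i x y; have E b : (P + Q) b = P b + Q b by [].
    by rewrite !E P2 Q2 mulrDr mulrDl addrACA.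
  + move=> t a; have E b : (P + Q) b = P b + Q b by [].
    by rewrite !E (P3 t) (Q3 t) mulrDr.
- move=> k P /asboolP[P1 P2 P3]; apply/asboolP.
  have E b : (k *: P) b = k *: P b by [].
  split.
  + by move=> a i c x y; rewrite !E P1 scalerDr !scalerA mulrC.
  + by move=> a i x y; rewrite !E P2 scalerDr -scalerAr -scalerAl.
  + by move=> t a; rewrite !E (P3 t) scalerAr.
Qed.

HB.instance Definition _ n :=
  GRing.isSubmodClosed.Build K (('I_n -> S) -> S) (@multider_pred n)
    (@multider_closed n).

Record multider n := Multider {
  multider_fun :> ('I_n -> S) -> S;
  _ : multider_fun \in @multider_pred n
}.

HB.instance Definition _ n := [isSub for @multider_fun n].
HB.instance Definition _ n := [Choice of multider n by <:].
HB.instance Definition _ n := [SubChoice_isSubLmodule of multider n by <:].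

Lemma multiderP n (P : multider n) : is_multider P.
Proof. by case: P => P /= /asboolP. Qed.

Definition shuffle m n (t : 'S_(m + n)) : bool :=
  [forall i : 'I_m, forall j : 'I_m,
    (i < j)%N ==> (t (lshift n i) < t (lshift n j))%N] &&
  [forall i : 'I_n, forall j : 'I_n,
    (i < j)%N ==> (t (rshift m i) < t (rshift m j))%N].

Definition wedge_fun m n (P : ('I_m -> S) -> S) (Q : ('I_n -> S) -> S)
    (a : 'I_(m + n) -> S) : S :=
  \sum_(t : 'S_(m + n) | shuffle t)
    (-1) ^+ t * P (fun i => a (t (lshift n i))) * Q (fun j => a (t (rshift m j))).

End Multiderivations.

Section Shuffles.
Variables m n : nat.
Implicit Types (al : 'S_m) (be : 'S_n) (t u s : 'S_(m + n)).

Definition block_fun (al : 'I_m -> 'I_m) (be : 'I_n -> 'I_n) (i : 'I_(m + n)) :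
    'I_(m + n) :=
  match fintype.split i with inl j => lshift n (al j) | inr j => rshift m (be j) end.

Fact block_fun_inj al be : injective (block_fun al be).
Proof.
apply: (can_inj (g := block_fun (al^-1)%g (be^-1)%g)) => i; rewrite /block_fun.
by case: (split_ordP i) => j ->; rewrite (unsplitK (inl _), unsplitK (inr _)) permK.
Qed.

Definition block_perm al be : 'S_(m + n) := perm (@block_fun_inj al be).

Fact block_permL al be i : block_perm al be (lshift n i) = lshift n (al i).
Proof. by rewrite permE /block_fun (unsplitK (inl _)). Qed.

Fact block_permR al be i : block_perm al be (rshift m i) = rshift m (be i).
Proof. by rewrite permE /block_fun (unsplitK (inr _)). Qed.

Fact block_permM al be al' be' :
  (block_perm al be * block_perm al' be')%g = block_perm (al * al')%g (be * be')%g.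
Proof.
apply/permP => i; rewrite permM; case: (split_ordP i) => j ->.
  by rewrite !block_permL permM.
by rewrite !block_permR permM.
Qed.

Fact block_perm1 : block_perm 1%g 1%g = 1%g.
Proof.
by apply/permP => i; case: (split_ordP i) => j ->;
  rewrite ?block_permL ?block_permR !perm1.
Qed.

Fact block_permV al be : ((block_perm al be)^-1)%g = block_perm (al^-1)%g (be^-1)%g.
Proof.
apply: (mulgI (block_perm al be)).
by rewrite mulgV block_permM !mulgV block_perm1.
Qed.

Fact odd_block_permL al : block_perm al 1%g = al :> bool.
Proof.
case: (prod_tpermP al) => ts ->{al} _.
elim: ts => [|[x y] ts IHts]; first by rewrite big_nil block_perm1 !odd_perm1.
rewrite big_cons -[X in block_perm _ X](mulg1 1%g) -block_permM !odd_permM {}IHts.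
congr (_ (+) _); rewrite odd_tperm/=.
have -> : block_perm (tperm x y) 1%g = tperm (lshift n x) (lshift n y).
  apply/permP => i; case: (split_ordP i) => j ->.
    rewrite block_permL; case: (tpermP x y j) => [->|->|xj yj].
    - by rewrite tpermL.
    - by rewrite tpermR.
    - by rewrite tpermD// (inj_eq (@lshift_inj _ _)) eq_sym; apply/eqP.
  by rewrite block_permR perm1 tpermD// eq_lrshift.
by rewrite odd_tperm (inj_eq (@lshift_inj _ _)).
Qed.

Fact odd_block_permR be : block_perm 1%g be = be :> bool.
Proof.
case: (prod_tpermP be) => ts ->{be} _.
elim: ts => [|[x y] ts IHts]; first by rewrite big_nil block_perm1 !odd_perm1.
rewrite big_cons -[X in block_perm X _](mulg1 1%g) -block_permM !odd_permM {}IHts.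
congr (_ (+) _); rewrite odd_tperm/=.
have -> : block_perm 1%g (tperm x y) = tperm (rshift m x) (rshift m y).
  apply/permP => i; case: (split_ordP i) => j ->.
    by rewrite block_permL perm1 tpermD// eq_rlshift.
  rewrite block_permR; case: (tpermP x y j) => [->|->|xj yj].
  - by rewrite tpermL.
  - by rewrite tpermR.
  - by rewrite tpermD// (inj_eq (@rshift_inj _ _)) eq_sym; apply/eqP.
by rewrite odd_tperm (inj_eq (@rshift_inj _ _)).
Qed.

Fact odd_block_perm al be : block_perm al be = al (+) be :> bool.
Proof.
by rewrite -[al in LHS]mulg1 -[be in LHS]mul1g -block_permM odd_permM
  odd_block_permL odd_block_permR.
Qed.

End Shuffles.

Fact incr_perm1 m (al : 'S_m) :
  (forall i j : 'I_m, (i < j)%N -> (al i < al j)%N) -> al = 1%g.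
Proof.
have geid (be : 'S_m) : (forall i j : 'I_m, (i < j)%N -> (be i < be j)%N) ->
    forall i : 'I_m, (i <= be i)%N.
  move=> bei [i]; elim: i => // i IHi im.
  have im' := ltnW im.
  by apply: leq_ltn_trans (IHi im') (bei (Ordinal im') (Ordinal im) (ltnSn i)).
move=> ali; apply/permP => i; rewrite perm1; apply/val_inj/eqP.
rewrite eqn_leq (geid _ ali) andbT.
have := geid (al^-1)%g _ (al i); rewrite permK; apply=> j k jk.
rewrite ltnNge leq_eqVlt; apply/negP => /orP[/eqP/val_inj/perm_inj kj|/ali].
  by move: jk; rewrite kj ltnn.
by rewrite !permKV ltnNge (ltnW jk).
Qed.

Fact sorting_perm m p (f : 'I_m -> 'I_p) : injective f ->
  exists al : 'S_m, forall i j : 'I_m, (i < j)%N -> (f (al i) < f (al j))%N.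
Proof.
move=> finj; pose g := [tuple (f i : nat) | i < m].
have gs : size (sort leq g) = m by rewrite size_sort size_tuple.
pose h := @Tuple m nat _ (introT eqP gs).
have /tuple_permP[al hal] : perm_eq h g by rewrite perm_sort.
exists al => i j ij.
have srt : sorted ltn h.
  rewrite ltn_sorted_uniq_leq sort_uniq (sort_sorted leq_total) andbT /g.
  rewrite map_inj_uniq ?enum_uniq//.
  by move=> x y /val_inj/finj.
have E k : nth 0%N h k = nth 0%N h k by [].
have val_h (k : 'I_m) : nth 0%N h k = f (al k).
  by rewrite hal -tnth_nth tnth_mktuple tnth_mktuple.
rewrite -!val_h; apply: (sorted_ltn_nth ltn_trans 0%N srt) => //;
  by rewrite inE size_tuple ltn_ord.
Qed.

Section ShuffleSum.
Variables (m n : nat) (V : zmodType) (f : 'S_(m + n) -> V).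
Hypothesis f_inv : forall al be t, f (block_perm al be * t)%g = f t.

Local Notation shuffle := (@shuffle m n).

Fact shuffle_rep (t : 'S_(m + n)) :
  exists ab : 'S_m * 'S_n, shuffle (block_perm ab.1 ab.2 * t)%g.
Proof.
have [|al hal] := @sorting_perm m _ (fun i => t (lshift n i)).
  by move=> x y /perm_inj/lshift_inj.
have [|be hbe] := @sorting_perm n _ (fun i => t (rshift m i)).
  by move=> x y /perm_inj/rshift_inj.
exists (al, be); apply/andP; split; apply/forallP => i; apply/forallP => j;
  apply/implyP => ij; rewrite !permM.
  by rewrite !block_permL; apply: hal.
by rewrite !block_permR; apply: hbe.
Qed.

Fact shuffle_uniq al be (t : 'S_(m + n)) :
  shuffle t -> shuffle (block_perm al be * t)%g -> (block_perm al be * t)%g = t.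
Proof.
move=> /andP[/forallP tl /forallP tr] /andP[/forallP ul /forallP ur].
suff [-> ->] : al = 1%g /\ be = 1%g by rewrite block_perm1 mul1g.
split; apply: incr_perm1 => i j ij.
  have := implyP (forallP (ul i) j) ij; rewrite !permM !block_permL => h.
  rewrite ltnNge leq_eqVlt; apply/negP => /orP[/eqP/val_inj e|e].
    by move: h; rewrite e ltnn.
  by have := implyP (forallP (tl _) _) e; rewrite ltnNge (ltnW h).
have := implyP (forallP (ur i) j) ij; rewrite !permM !block_permR => h.
rewrite ltnNge leq_eqVlt; apply/negP => /orP[/eqP/val_inj e|e].
  by move: h; rewrite e ltnn.
by have := implyP (forallP (tr _) _) e; rewrite ltnNge (ltnW h).
Qed.

Fact sum_shuffle_mulr (s : 'S_(m + n)) :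
  \sum_(t | shuffle t) f (t * s)%g = \sum_(t | shuffle t) f t.
Proof.
pose b (t : 'S_(m + n)) :=
  let ab := xchoose (shuffle_rep t) in block_perm ab.1 ab.2.
pose rep t := (b t * t)%g.
have repP t : shuffle (rep t) by apply: xchooseP (shuffle_rep t).
have rep_id al be t : shuffle t -> rep (block_perm al be * t)%g = t.
  move=> ht; have := repP (block_perm al be * t)%g.
  by rewrite /rep /b mulgA block_permM; apply: shuffle_uniq.
have cancel_rep u t : shuffle t -> rep (rep (t * u) * u^-1)%g = t.
  move=> ht; rewrite {2}/rep /b -mulgA mulgK; exact: rep_id.
rewrite [RHS](reindex_onto (fun t : 'S_(m + n) => rep (t * s)%g)
  (fun t : 'S_(m + n) => rep (t * s^-1)%g)).
  apply: eq_big => [t|t _]; last by rewrite /rep /b f_inv.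
  rewrite repP andTb; apply/idP/eqP => [|<-]; [exact: cancel_rep|exact: repP].
by move=> t ht; have := cancel_rep (s^-1)%g t ht; rewrite invgK.
Qed.

End ShuffleSum.

Section Wedge.
Variables (K : fieldType) (S : comAlgType K).

Let mul_derl (s p p' q x y : S) :
  s * (x * p + p' * y) * q = x * (s * p * q) + s * p' * q * y.
Proof. by rewrite mulrDr mulrDl mulrCA -!mulrA [y * q]mulrC. Qed.

Let mul_derr (s p q q' x y : S) :
  s * p * (x * q + q' * y) = x * (s * p * q) + s * p * q' * y.
Proof. by rewrite mulrDr mulrCA -!mulrA. Qed.

Let mul_sign (u v s p q : S) :
  u * v * s * p * q = s * (u * p) * (v * q).
Proof. by rewrite [u * v * s]mulrC -!mulrA [v * (p * q)]mulrCA. Qed.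

Fact upd_in p q (f : 'I_p -> 'I_q) (a : 'I_q -> S) i j x : injective f ->
  f j = i -> (fun l => upd a i x (f l)) = upd (fun l => a (f l)) j x.
Proof. by move=> fi <-; apply/funext => l; rewrite /upd (inj_eq fi). Qed.

Fact upd_out p q (f : 'I_p -> 'I_q) (a : 'I_q -> S) i x :
  (forall l, f l != i) -> (fun l => upd a i x (f l)) = (fun l => a (f l)).
Proof. by move=> fi; apply/funext => l; rewrite /upd (negPf (fi l)). Qed.

Fact wedge_subproof m n (P : multider S m) (Q : multider S n) :
  wedge_fun P Q \in @multider_pred K S (m + n).
Proof.
have [P1 P2 P3] := multiderP P; have [Q1 Q2 Q3] := multiderP Q.
have Linj (t : 'S_(m + n)) : injective (fun i => t (lshift n i)).
  by move=> x y /perm_inj/lshift_inj.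
have Rinj (t : 'S_(m + n)) : injective (fun i => t (rshift m i)).
  by move=> x y /perm_inj/rshift_inj.
have LR (t : 'S_(m + n)) i j : t (lshift n i) != t (rshift m j).
  by rewrite (inj_eq perm_inj) eq_lrshift.
have RL (t : 'S_(m + n)) i j : t (rshift m i) != t (lshift n j).
  by rewrite (inj_eq perm_inj) eq_rlshift.
apply/asboolP; split.
- move=> a i c x y; rewrite /wedge_fun scaler_sumr -big_split/=.
  apply: eq_bigr => t _; case: (split_ordP ((t^-1)%g i)) => j ij.
    have {ij} tj : t (lshift n j) = i by rewrite -ij permKV.
    have out z : (fun l => upd a i z (t (rshift m l))) = (fun l => a (t (rshift m l))).
      by apply: (upd_out (f := fun l => t (rshift m l))) => l; rewrite -tj RL.
    have inn z : (fun l => upd a i z (t (lshift n l))) =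
        upd (fun l => a (t (lshift n l))) j z by apply: upd_in (Linj t) tj.
    rewrite !out !inn.
    by rewrite P1 mulrDr mulrDl -scalerAr -scalerAl.
  have {ij} tj : t (rshift m j) = i by rewrite -ij permKV.
  have out z : (fun l => upd a i z (t (lshift n l))) = (fun l => a (t (lshift n l))).
    by apply: (upd_out (f := fun l => t (lshift n l))) => l; rewrite -tj LR.
  have inn z : (fun l => upd a i z (t (rshift m l))) =
      upd (fun l => a (t (rshift m l))) j z by apply: upd_in (Rinj t) tj.
  rewrite !out !inn.
  by rewrite Q1 mulrDr -scalerAr.
- move=> a i x y; rewrite /wedge_fun mulr_sumr mulr_suml -big_split/=.
  apply: eq_bigr => t _; case: (split_ordP ((t^-1)%g i)) => j ij.
    have {ij} tj : t (lshift n j) = i by rewrite -ij permKV.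
    have out z : (fun l => upd a i z (t (rshift m l))) = (fun l => a (t (rshift m l))).
      by apply: (upd_out (f := fun l => t (rshift m l))) => l; rewrite -tj RL.
    have inn z : (fun l => upd a i z (t (lshift n l))) =
        upd (fun l => a (t (lshift n l))) j z by apply: upd_in (Linj t) tj.
    rewrite !out !inn.
    by rewrite P2 mul_derl.
  have {ij} tj : t (rshift m j) = i by rewrite -ij permKV.
  have out z : (fun l => upd a i z (t (lshift n l))) = (fun l => a (t (lshift n l))).
    by apply: (upd_out (f := fun l => t (lshift n l))) => l; rewrite -tj LR.
  have inn z : (fun l => upd a i z (t (rshift m l))) =
      upd (fun l => a (t (rshift m l))) j z by apply: upd_in (Rinj t) tj.
  rewrite !out !inn.
  by rewrite Q2 mul_derr.
- move=> s a; pose f (t : 'S_(m + n)) :=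
    (-1) ^+ t * P (fun i => a (t (lshift n i))) * Q (fun j => a (t (rshift m j))).
  have f_inv al be t : f (block_perm al be * t)%g = f t.
    have -> : f t = (-1) ^+ t *
        ((-1) ^+ al * P ((fun i => a (t (lshift n i))) \o al)) *
        ((-1) ^+ be * Q ((fun j => a (t (rshift m j))) \o be)).
      by rewrite -P3 -Q3.
    have -> : (fun i => a (t (lshift n i))) \o al =
        (fun i => a ((block_perm al be * t)%g (lshift n i))).
      by apply/funext => i /=; rewrite permM block_permL.
    have -> : (fun j => a (t (rshift m j))) \o be =
        (fun j => a ((block_perm al be * t)%g (rshift m j))).
      by apply/funext => j /=; rewrite permM block_permR.
    by rewrite /f odd_permM odd_block_perm !signr_addb mul_sign.
  rewrite {1}/wedge_fun -/f -(sum_shuffle_mulr f_inv s) mulr_sumr.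
  apply: eq_bigr => t _; rewrite /f odd_permM signr_addb.
  have -> : (fun i => a ((t * s)%g (lshift n i))) = (fun i => (a \o s) (t (lshift n i))).
    by apply/funext => i; rewrite permM.
  have -> : (fun j => a ((t * s)%g (rshift m j))) = (fun j => (a \o s) (t (rshift m j))).
    by apply/funext => j; rewrite permM.
  by rewrite [_ * (-1) ^+ s]mulrC -!mulrA.
Qed.

Definition wedge m n (P : multider S m) (Q : multider S n) : multider S (m + n) :=
  Multider (wedge_subproof P Q).

End Wedge.

Section FrobeniusPoisson.
Variables (K : fieldType) (S : comAlgType K).

Record poisson_bracket := PoissonBracket {
  pb :> S -> S -> S;
  pb_linl : forall c x y z, pb (c *: x + y) z = c *: pb x z + pb y z;
  pb_linr : forall c x y z, pb z (c *: x + y) = c *: pb z x + pb z y;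
  pb_alt : forall x, pb x x = 0;
  pb_jacobi : forall x y z, pb x (pb y z) + pb y (pb z x) + pb z (pb x y) = 0;
  pb_derl : forall x y z, pb (x * y) z = x * pb y z + pb x z * y;
  pb_derr : forall x y z, pb z (x * y) = x * pb z y + pb z x * y
}.

(* An isomorphism of S-modules from S to its linear dual, S acting on the dual
   by (a f)(x) = f (a x). It forces S to be finite-dimensional. *)
Record frobenius_iso := FrobeniusIso {
  frob :> S -> {scalar S};
  frob_lin : forall c b b' x, frob (c *: b + b') x = c * frob b x + frob b' x;
  frob_mod : forall a b x, frob (a * b) x = frob b (a * x);
  frob_inj : forall b b', frob b =1 frob b' -> b = b';
  frob_surj : forall f : {scalar S}, exists b, frob b =1 f
}.

Definition frob_form (F : frobenius_iso) (a b : S) : K := F b a.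

Definition arg_rcons n (a : 'I_n -> S) (x : S) : 'I_n.+1 -> S :=
  fun i => if unlift ord_max i is Some j then a j else x.

(* The arity of P is n.+1, hence the sign (-1) ^+ n. The element selected by
   xget exists and is unique when P is a multiderivation, see Delta_funP. *)
Definition Delta_fun (F : frobenius_iso) n (P : ('I_n.+1 -> S) -> S)
    (a : 'I_n -> S) : S :=
  xget 0 [set b | forall x,
    frob_form F b x = (-1) ^+ n * frob_form F (P (arg_rcons a x)) 1].

Section DeltaMultider.
Variable F : frobenius_iso.

Fact frob_formC a b : frob_form F a b = frob_form F b a.
Proof.
have E u v : F u v = F 1 (u * v) by rewrite -{1}[u]mulr1 frob_mod.
by rewrite /frob_form E mulrC -E.
Qed.

Fact frob_formMl a b c : frob_form F (a * b) c = frob_form F b (a * c).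
Proof. by rewrite /frob_form frob_mod. Qed.

Fact frob_form_nondeg a b : (forall x, frob_form F a x = frob_form F b x) -> a = b.
Proof.
move=> h; apply: (@frob_inj F) => x; have := h x; rewrite frob_formC => e.
by transitivity (frob_form F b x); [exact: e|exact: frob_formC].
Qed.

Fact frob_formDl a b c : frob_form F (a + b) c = frob_form F a c + frob_form F b c.
Proof. by rewrite /frob_form linearD. Qed.

Fact frob_formZl k a c : frob_form F (k *: a) c = k * frob_form F a c.
Proof. by rewrite /frob_form linearZ. Qed.

Fact arg_rcons_upd n (a : 'I_n -> S) i x y :
  arg_rcons (upd a i y) x = upd (arg_rcons a x) (lift ord_max i) y.
Proof.
apply/funext => j; rewrite /arg_rcons /upd.
case: unliftP => [k ->|->]; first by rewrite (inj_eq lift_inj).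
by rewrite (negPf (neq_lift _ _)).
Qed.

Fact arg_rcons_last n (a : 'I_n -> S) x :
  arg_rcons a x = upd (arg_rcons a 0) ord_max x.
Proof.
apply/funext => j; rewrite /arg_rcons /upd.
by case: unliftP => [k ->|->]; rewrite ?eqxx// eq_sym (negPf (neq_lift _ _)).
Qed.

Fact arg_rcons_perm n (a : 'I_n -> S) (t : 'S_n) x :
  arg_rcons (a \o t) x = arg_rcons a x \o lift_perm ord_max ord_max t.
Proof.
apply/funext => j /=; rewrite /arg_rcons.
case: (unliftP ord_max j) => [k ->|->]; first by rewrite lift_perm_lift liftK.
by rewrite lift_perm_id unlift_none.
Qed.

Variables (n : nat) (P : multider S n.+1).

Fact Delta_funP a x :
  frob_form F (Delta_fun F P a) x =
  (-1) ^+ n * frob_form F (P (arg_rcons a x)) 1.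
Proof.
have [P1 _ _] := multiderP P.
pose f x : K^o := (-1) ^+ n * frob_form F (P (arg_rcons a x)) 1.
have f_lin : linear f.
  move=> c y z; rewrite /f (arg_rcons_last _ (_ + _)) P1 -!arg_rcons_last.
  by rewrite frob_formDl frob_formZl mulrDr mulrCA.
pose fl := GRing.isLinear.Build K S K^o _ f f_lin.
pose g : {scalar S} := HB.pack f fl.
have [b hb] := frob_surj F g.
have hex : exists b, forall x,
    frob_form F b x = (-1) ^+ n * frob_form F (P (arg_rcons a x)) 1.
  by exists b => z; rewrite frob_formC -[RHS]/(g z) -hb.
by move: x; exact: (xgetPex (0 : S) hex).
Qed.

Fact Delta_subproof : Delta_fun F P \in @multider_pred K S n.
Proof.
have [P1 P2 P3] := multiderP P.
apply/asboolP; split.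
- move=> a i c x y; apply: frob_form_nondeg => z.
  rewrite frob_formDl frob_formZl !Delta_funP !arg_rcons_upd P1.
  by rewrite frob_formDl frob_formZl mulrDr mulrCA.
- move=> a i x y; apply: frob_form_nondeg => z.
  set a' := arg_rcons a 0.
  have swap u v : P (upd (upd a' (lift ord_max i) u) ord_max v) =
      - P (upd (upd a' (lift ord_max i) v) ord_max u).
    rewrite (P3 (tperm (lift ord_max i) ord_max)) odd_tperm eq_sym neq_lift.
    rewrite expr1 mulN1r; congr (- P _); apply/funext => j /=; rewrite /upd.
    case: tpermP => [->|->|/eqP/negPf -> /eqP/negPf ->//].
    + by rewrite eqxx eq_sym (negPf (neq_lift _ _)) eqxx.
    + by rewrite eqxx eq_sym (negPf (neq_lift _ _)) eqxx.
  have upd_last u v : arg_rcons (upd a i u) v =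
      upd (upd a' (lift ord_max i) u) ord_max v.
    rewrite arg_rcons_upd arg_rcons_last; apply/funext => j; rewrite /upd /a'.
    rewrite /arg_rcons; case: unliftP => [k ->|->].
      by rewrite [_ == ord_max]eq_sym (negPf (neq_lift _ _)).
    by rewrite eqxx (negPf (neq_lift _ _)).
  rewrite [Delta_fun F P _ * y]mulrC frob_formDl !frob_formMl !Delta_funP.
  rewrite -mulrDr -frob_formDl !upd_last; congr (_ * frob_form _ _ _).
  pose p u v := P (upd (upd a' (lift ord_max i) u) ord_max v).
  rewrite -![P _]/(p _ _).
  have pC u v : p u v = - p v u by apply: swap.
  have pM u v w : p u (v * w) = v * p u w + p u v * w by apply: P2.
  rewrite pC !pM [p z y]pC [p z x]pC [p x y]pC mulrN !mulNr opprD !opprK.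
  by rewrite addrACA subrr addr0 [y * _]mulrC.
- move=> t a; apply: frob_form_nondeg => z.
  have E b w : frob_form F ((-1) ^+ t * b) w = (-1) ^+ t * frob_form F b w.
    by case: (t : bool); rewrite ?mul1r// !mulN1r -scaleN1r frob_formZl mulN1r.
  rewrite E !Delta_funP arg_rcons_perm mulrCA -E.
  by rewrite (P3 (lift_perm ord_max ord_max t) (arg_rcons a z)) odd_lift_perm addbb addFb.
Qed.

Definition Delta : multider S n := Multider Delta_subproof.

End DeltaMultider.

Section PoissonCohomology.
Variable pi : poisson_bracket.

Fact pb_skew x y : pi x y = - pi y x.
Proof.
have DL u v w : pi (u + v) w = pi u w + pi v w.
  by have := pb_linl pi 1 u v w; rewrite !scale1r.
have DR u v w : pi w (u + v) = pi w u + pi w v.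
  by have := pb_linr pi 1 u v w; rewrite !scale1r.
have := pb_alt pi (x + y); rewrite DL !DR !pb_alt add0r addr0.
by move/eqP; rewrite addr_eq0 => /eqP.
Qed.

Definition pb_fun (a : 'I_2 -> S) : S := pi (a ord0) (a ord_max).

Fact pb_subproof : pb_fun \in @multider_pred K S 2.
Proof.
apply/asboolP; split.
- move=> a [[|[|//]] i2] c x y; rewrite /pb_fun /upd/=.
    exact: pb_linl.
  exact: pb_linr.
- move=> a [[|[|//]] i2] x y; rewrite /pb_fun /upd/=.
    exact: pb_derl.
  exact: pb_derr.
- move=> t a; rewrite /pb_fun /=.
  have I2 (i : 'I_2) : i = ord0 \/ i = ord_max.
    by case: i => [[|[|//]] i2]; [left|right]; apply: val_inj.
  have : t = 1%g \/ t = tperm ord0 ord_max.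
    have t01 : t ord0 <> t ord_max by move/perm_inj.
    case: (I2 (t ord0)) (I2 (t ord_max)) t01 => [t0|t0] [t1|t1];
      rewrite t0 t1 // => _; [left|right]; apply/permP => i;
      by case: (I2 i) => ->; rewrite ?perm1 ?tpermL ?tpermR.
  case=> ->; first by rewrite !perm1 odd_perm1 mul1r.
  by rewrite tpermL tpermR odd_tperm/= mulN1r -pb_skew.
Qed.

Definition pb_multider : multider S 2 := Multider pb_subproof.

(* In the second sum, the arguments of P are the bracket followed by the y l
   for l different from i and j, in increasing order; bump j (bump i p) is the
   p-th such index when i < j. *)
Definition delta_fun n (P : ('I_n -> S) -> S) (y : 'I_n.+1 -> S) : S :=
  \sum_(i < n.+1) (-1) ^+ i * pi (y i) (P (fun l => y (lift i l)))
  + \sum_(i < n.+1) \sum_(j < n.+1 | (i < j)%N)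
      (-1) ^+ (i + j) * P (fun l : 'I_n =>
        if l == 0%N :> nat then pi (y i) (y j)
        else y (inord (bump j (bump i l.-1)))).

Fact delta_fun_lin n (c : K) (P Q : ('I_n -> S) -> S) :
  delta_fun (c *: P + Q) = c *: delta_fun P + delta_fun Q.
Proof.
apply/funext => y; have E b : (c *: P + Q) b = c *: P b + Q b by [].
rewrite -[RHS]/(c *: delta_fun P y + delta_fun Q y) /delta_fun.
rewrite scalerDr addrACA; congr (_ + _).
  rewrite scaler_sumr -big_split; apply: eq_bigr => i _.
  by rewrite E pb_linr mulrDr scalerAr.
rewrite scaler_sumr -big_split; apply: eq_bigr => i _ /=.
rewrite scaler_sumr -big_split; apply: eq_bigr => j _ /=.
by rewrite E mulrDr scalerAr.
Qed.

Fact delta_fun0 n : delta_fun (0 : ('I_n -> S) -> S) = 0.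
Proof.
by have := delta_fun_lin (-1) (0 : ('I_n -> S) -> S) 0;
  rewrite scaler0 addr0 scaleN1r addNr.
Qed.

(* Cocycles and coboundaries only involve the values of the differential, so it
   is left as an operation on arbitrary maps. *)
Definition cocycle_pred n : {pred multider S n} :=
  fun P => delta_fun P == 0.

Fact cocycle_closed n : subsemimod_closed (@cocycle_pred n).
Proof.
split; first split.
- by apply/eqP; apply: delta_fun0.
- move=> P Q /eqP P0 /eqP Q0; apply/eqP.
  by have := delta_fun_lin 1 P Q; rewrite !scale1r P0 Q0 addr0.
- move=> c P /eqP P0; apply/eqP.
  by have := delta_fun_lin c P 0; rewrite !addr0 P0 delta_fun0 scaler0 addr0.
Qed.

HB.instance Definition _ n :=
  GRing.isSubmodClosed.Build K (multider S n) (@cocycle_pred n)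
    (@cocycle_closed n).

Record cocycle n := Cocycle {
  cocycle_multider :> multider S n;
  _ : cocycle_multider \in @cocycle_pred n
}.

HB.instance Definition _ n := [isSub for @cocycle_multider n].
HB.instance Definition _ n := [Choice of cocycle n by <:].
HB.instance Definition _ n := [SubChoice_isSubLmodule of cocycle n by <:].

Definition is_coboundary n : (('I_n -> S) -> S) -> Prop :=
  if n is m.+1 then fun P => exists Q : multider S m, P = delta_fun Q
  else fun P => P = 0.

Definition coboundary_pred n : {pred cocycle n} := fun P => `[< is_coboundary P >].

Fact coboundary_closed n : subsemimod_closed (@coboundary_pred n).
Proof.
split; first split.
- apply/asboolP; case: n => [//|n]; exists 0; symmetry; exact: delta_fun0.
- move=> P Q /asboolP hP /asboolP hQ; apply/asboolP.
  have -> : multider_fun (P + Q) = multider_fun P + multider_fun Q by [].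
  case: n P Q hP hQ => [|n] P Q; first by move=> /= -> ->; rewrite addr0.
  move=> [P' ->] [Q' ->]; exists (P' + Q').
  by have := delta_fun_lin 1 P' Q'; rewrite !scale1r.
- move=> c P /asboolP hP; apply/asboolP.
  have -> : multider_fun (c *: P) = c *: multider_fun P by [].
  case: n P hP => [|n] P; first by move=> /= ->; rewrite scaler0.
  move=> [P' ->]; exists (c *: P').
  by have := delta_fun_lin c P' 0; rewrite !addr0 delta_fun0 addr0.
Qed.

HB.instance Definition _ n :=
  GRing.isSubmodClosed.Build K (cocycle n) (@coboundary_pred n)
    (@coboundary_closed n).

Definition HPn n : lmodType K := lquot (@coboundary_pred n).

Definition HPclass n (P : cocycle n) : HPn n := lpi (@coboundary_pred n) P.

End PoissonCohomology.
End FrobeniusPoisson.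

Section TotalSpaces.
Variables (K : fieldType) (S : comAlgType K).

Definition multider_mod (n : nat) : lmodType K := multider S n.

Definition multiders : lmodType K := dsum multider_mod.

Definition total_wedge (x y : multiders) : multiders :=
  \sum_(m \in [set: nat]) \sum_(n \in [set: nat])
    dinj (A := multider_mod) (wedge (dcomp x m) (dcomp y n)).

Definition total_Delta (F : frobenius_iso S) (x : multiders) : multiders :=
  \sum_(n \in [set: nat])
    dinj (A := multider_mod) (Delta F (dcomp x n.+1)).

Fact const_subproof (s : S) : (fun=> s) \in @multider_pred K S 0.
Proof.
apply/asboolP; split=> [a []|a []|t a] //.
have -> : t = 1%g by apply/permP => -[].
by rewrite odd_perm1 mul1r.
Qed.

Definition const_multider (s : S) : multider S 0 := Multider (const_subproof s).

Definition total_one : multiders :=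
  dinj (A := multider_mod) (const_multider 1).

Definition multiders_gr : int -> multiders -> Prop :=
  @dgrade K multider_mod.

Definition unimodular (F : frobenius_iso S) (pi : poisson_bracket S) : Prop :=
  Delta F (pb_multider pi) = 0.

Section HP.
Variable pi : poisson_bracket S.

Definition HP : lmodType K := dsum (HPn pi).

Definition HPinj n (P : cocycle pi n) : HP := dinj (A := HPn pi) (HPclass P).

Definition HP_gr : int -> HP -> Prop := @dgrade K (HPn pi).

Fact one_cocycle_subproof : const_multider 1 \in @cocycle_pred K S pi 0.
Proof.
apply/eqP/funext => y; rewrite /delta_fun !big_ord1 /= big_mkcond big_ord1 addr0.
rewrite mul1r; have := pb_derr pi 1 1 (y ord0).
rewrite !mulr1 mul1r => /eqP.
by rewrite addrC -subr_eq subrr eq_sym => /eqP.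
Qed.

Definition HP_one : HP := HPinj (Cocycle one_cocycle_subproof).

(* Being induced includes that cocycles are stable under the operation. Since
   the elements HPinj P span HP(S), these conditions determine a bilinear mul
   and a linear D. *)
Definition induced_by_wedge (mul : HP -> HP -> HP) : Prop :=
  forall m n (P : cocycle pi m) (Q : cocycle pi n),
  exists2 R : cocycle pi (m + n), wedge P Q = R &
    mul (HPinj P) (HPinj Q) = HPinj R.

Definition induced_by_Delta (F : frobenius_iso S) (D : HP -> HP) : Prop :=
  (forall P : cocycle pi 0, D (HPinj P) = 0) /\
  (forall n (P : cocycle pi n.+1),
   exists2 R : cocycle pi n, Delta F P = R & D (HPinj P) = HPinj R).

End HP.
End TotalSpaces.

(* Main.v *)
(* A multiderivation of degree m is encoded as a function on lists of elements
   of S that vanishes on lists of length different from m, so that X(S) embeds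
   in seq S -> S.  Fixing the first argument gives contractions i_x.  They are
   graded derivations of the wedge product, anticommute with Delta, and satisfy
   i_x delta + delta i_x = L_x, with L_x the Lie derivative along {x, -}.  An
   element of positive degree vanishes once all its contractions do, so each
   identity is proved by induction on the list of arguments, and only its
   degree 0 instance has to be computed.  In this way the failure of Delta to
   be a derivation of the wedge product is identified with the Schouten
   bracket, which satisfies the graded Leibniz rule and Jacobi identity.

   Writing l(a) = <a, 1>, unimodularity says that l({a, b}) = 0, from which L_x
   commutes with Delta, and hence Delta anticommutes with delta; this and the
   derivation property of delta make both operations descend to cohomology. *)
Require Import Defs.
From HB Require Import structures.
From mathcomp Require Import all_boot all_order all_algebra perm ring zify.
From mathcomp Require Import boolp classical_sets functions fsbigop.

Set Implicit Arguments.
Unset Strict Implicit.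
Unset Printing Implicit Defensive.

Import GRing.Theory.
Local Open Scope ring_scope.

(** * Calculus on lists of arguments *)

Section Contraction.
Variables (K : fieldType) (S : comAlgType K).
Local Notation T := (seq S -> S).
Implicit Types (f g h : T) (s : seq S) (x y z : S).

(** The obstacle is arity. On the graded pieces, associativity or the Jacobi identity compares maps
    whose numbers of arguments agree only up to a cast, and every product is a sum over shuffles. On
    list functions neither shows, elements with several components are treated at once, and signs
    are carried by the involution [eps] or by parities. Contracting a product changes its factors,
    so each induction generalises over the functions involved. The Leibniz rule and the Jacobi
    identity are proved for the recursive bracket without the Frobenius form, which enters only in
    the statements on [div]. Both halves of the theorem go through one criterion, phrased with the
    obstruction instead of the bracket; its conditions pass from cocycles to their classes. *)

Definition ctr x f : T := fun s => f (x :: s).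
(* The grading involution. *)
Definition eps f : T := fun s => (-1) ^+ size s * f s.

(* The wedge product, defined by the derivation property of contractions; wdg_evn
   compares it with the sum over shuffles. *)
Fixpoint wdg f g s : S :=
  if s is x :: s' then wdg (ctr x f) g s' + wdg (eps f) (ctr x g) s'
  else f [::] * g [::].

(* The Schouten bracket up to sign: the obstruction for Delta to be a derivation
   of the wedge product, see div_wdg. *)
Fixpoint schouten f g s : S :=
  if s is x :: s' then - schouten (ctr x f) g s' - schouten (eps f) (ctr x g) s'
  else - f [:: g [::]] - g [:: f [::]].

Lemma funD f g s : (f + g) s = f s + g s. Proof. by []. Qed.
Lemma funN f s : (- f) s = - f s. Proof. by []. Qed.
Definition funE := (funD, funN).

Lemma ctr_eps x f : ctr x (eps f) = - eps (ctr x f).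
Proof. by apply/funext => s; rewrite /ctr /eps !funE /= exprS !mulN1r mulNr. Qed.

Lemma epsK : involutive eps.
Proof. by move=> f; apply/funext => s; rewrite /eps mulrA -expr2 sqrr_sign mul1r. Qed.

Lemma eps_lin (a : S) f g :
  eps (fun t => a * f t + g t) = (fun t => a * eps f t + eps g t).
Proof. by apply/funext => t; rewrite /eps; ring. Qed.

Lemma epsN f : eps (- f) = - eps f.
Proof. by apply/funext => t; rewrite /eps !funE mulrN. Qed.

(** Linearity holds over S, not only over K, so signs and embedded scalars can be pulled out as ring
    elements. *)
Lemma wdg_linl (a : S) f g h s :
  wdg (fun t => a * f t + g t) h s = a * wdg f h s + wdg g h s.
Proof.
elim: s f g h => [|x s IH] f g h /=; first by ring.
by rewrite eps_lin [wdg (ctr x _) _ _]IH IH; ring.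
Qed.

Lemma wdg_linr (a : S) f g h s :
  wdg h (fun t => a * f t + g t) s = a * wdg h f s + wdg h g s.
Proof.
elim: s f g h => [|x s IH] f g h /=; first by ring.
by rewrite [wdg _ (ctr x _) _]IH IH; ring.
Qed.

Lemma addfE f g : f + g = fun t => 1 * f t + g t.
Proof. by apply/funext => t; rewrite mul1r. Qed.
Lemma mulfE (a : S) f : (fun t => a * f t) = fun t => a * f t + (0 : T) t.
Proof. by apply/funext => t; rewrite addr0. Qed.

Lemma wdgDl f g h s : wdg (f + g) h s = wdg f h s + wdg g h s.
Proof. by rewrite addfE wdg_linl mul1r. Qed.
Lemma wdgDr f g h s : wdg h (f + g) s = wdg h f s + wdg h g s.
Proof. by rewrite addfE wdg_linr mul1r. Qed.
Lemma wdg0l f s : wdg 0 f s = 0.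
Proof. by apply: (addrI (wdg 0 f s)); rewrite -wdgDl addr0 [RHS]addr0. Qed.
Lemma wdg0r f s : wdg f 0 s = 0.
Proof. by apply: (addrI (wdg f 0 s)); rewrite -wdgDr addr0 [RHS]addr0. Qed.
Lemma wdgMl (a : S) f g s : wdg (fun t => a * f t) g s = a * wdg f g s.
Proof. by rewrite mulfE wdg_linl wdg0l addr0. Qed.
Lemma wdgMr (a : S) f g s : wdg f (fun t => a * g t) s = a * wdg f g s.
Proof. by rewrite mulfE wdg_linr wdg0r addr0. Qed.
Lemma wdgNl f g s : wdg (- f) g s = - wdg f g s.
Proof. by apply: (addrI (wdg f g s)); rewrite -wdgDl !subrr wdg0l. Qed.
Lemma wdgNr f g s : wdg f (- g) s = - wdg f g s.
Proof. by apply: (addrI (wdg f g s)); rewrite -wdgDr !subrr wdg0r. Qed.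
Definition wdgE := (wdgDl, wdgDr, wdgNl, wdgNr, wdgMl, wdgMr).

Lemma ctr_wdg x f g :
  ctr x (wdg f g) = wdg (ctr x f) g + wdg (eps f) (ctr x g).
Proof. by []. Qed.

Lemma ctrE x f s : f (x :: s) = ctr x f s. Proof. by []. Qed.
Lemma epsE f s : eps f s = (-1) ^+ size s * f s. Proof. by []. Qed.

Lemma ctrN x f : ctr x (- f) = - ctr x f.
Proof. by apply/funext => s; rewrite /ctr !funN. Qed.

Lemma eps_wdg f g : eps (wdg f g) = wdg (eps f) (eps g).
Proof.
apply/funext => s; elim: s f g => [|x s IH] f g.
  by rewrite /eps /= !expr0 !mul1r.
rewrite ctrE ctr_eps ctr_wdg /= !ctr_eps !wdgE epsK -opprD funN; congr (- _).
by rewrite epsE funD mulrDr -IH; congr (_ + _); rewrite -{2}[f]epsK -IH.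
Qed.

Lemma wdgA f g h : wdg f (wdg g h) = wdg (wdg f g) h.
Proof.
apply/funext => s; elim: s f g h => [|x s IH] f g h /=; first by rewrite mulrA.
by rewrite !ctr_wdg eps_wdg !wdgE !IH addrA.
Qed.

Definition unit_fun : T := fun s => if s is [::] then 1 else 0.

Lemma eps_unit : eps unit_fun = unit_fun.
Proof. by apply/funext => -[|x s]; rewrite /eps /= ?mulr0 ?mul1r. Qed.

Lemma wdg1l f : wdg unit_fun f = f.
Proof.
apply/funext => s; elim: s f => [|x s IH] f /=; first by rewrite mul1r.
by rewrite -[ctr x _]/(0 : T) wdg0l add0r eps_unit IH.
Qed.

Lemma wdg1r f : wdg f unit_fun = f.
Proof.
apply/funext => s; elim: s f => [|x s IH] f /=; first by rewrite mulr1.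
by rewrite -[ctr x unit_fun]/(0 : T) wdg0r addr0 IH.
Qed.

(* f only has components of parity b. *)
Definition par (b : bool) f := forall s, odd (size s) != b -> f s = 0.

Lemma par_ctr b x f : par b f -> par (~~ b) (ctr x f).
Proof. by move=> fb s sb; apply: fb; move: sb => /=; case: b (odd _) => [] []. Qed.

Lemma par_eps b f : par b f -> par b (eps f).
Proof. by move=> fb s /fb; rewrite /eps => ->; rewrite mulr0. Qed.

Lemma par_opp b f : par b f -> par b (- f).
Proof. by move=> fb s /fb; rewrite funN => ->; rewrite oppr0. Qed.

Lemma eps_par b f : par b f -> eps f = fun s => (-1) ^+ b * f s.
Proof.
move=> fb; apply/funext => s; rewrite /eps -signr_odd.
by have [->//|/fb ->] := eqVneq (odd (size s)) b; rewrite !mulr0.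
Qed.

Lemma eps_parity b f : par b f -> eps f = if b then - f else f.
Proof.
by move=> fb; rewrite (eps_par fb); apply/funext => s; case: b {fb};
  rewrite ?mul1r ?mulN1r.
Qed.

Lemma wdgC a b f g s : par a f -> par b g ->
  wdg f g s = (-1) ^+ (a && b) * wdg g f s.
Proof.
elim: s a b f g => [|x s IH] a b f g fa gb /=.
  case: a b fa gb => [] [] fa gb /=; try by rewrite expr0 mul1r mulrC.
  (* Two odd functions remain. The sign is then -1, which is harmless because an odd function
     vanishes on the empty list. *)
  by rewrite (fa [::] isT) mulr0 mul0r mulr0.
rewrite (IH _ _ _ _ (par_ctr x fa) gb) (IH _ _ _ _ (par_eps fa) (par_ctr x gb)).
rewrite (eps_par fa) (eps_par gb) !wdgE.
by case: a b {fa gb} => [] [] /=; ring.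
Qed.

Lemma ctr_schouten x f g :
  ctr x (schouten f g) = - schouten (ctr x f) g - schouten (eps f) (ctr x g).
Proof. by []. Qed.


(** Skewness is asked for neighbouring arguments only: these transpositions generate all
    permutations, and the condition passes directly to contractions. No degree is fixed. *)
Record multi f : Prop := {
  multi_lin : forall p (c : K) x y s,
    f (p ++ (c *: x + y) :: s) = c *: f (p ++ x :: s) + f (p ++ y :: s);
  multi_der : forall p x y s,
    f (p ++ x * y :: s) = x * f (p ++ y :: s) + f (p ++ x :: s) * y;
  multi_swap : forall p x y s, f (p ++ x :: y :: s) = - f (p ++ y :: x :: s)
}.

Lemma multi_ctr x f : multi f -> multi (ctr x f).
Proof.
case=> f1 f2 f3; split=> p.
- by move=> *; apply: (f1 (x :: p)).
- by move=> *; apply: (f2 (x :: p)).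
- by move=> *; apply: (f3 (x :: p)).
Qed.

Lemma multi_eps f : multi f -> multi (eps f).
Proof.
case=> f1 f2 f3; split=> p *; rewrite !epsE !size_cat /=.
- by rewrite f1 mulrDr scalerAr.
- by rewrite f2; ring.
- by rewrite f3 mulrN.
Qed.

Lemma multiN f : multi f -> multi (- f).
Proof.
case=> f1 f2 f3; split=> p *; rewrite !funN.
- by rewrite f1 opprD scalerN.
- by rewrite f2; ring.
- by rewrite f3.
Qed.
Hint Resolve multi_ctr multi_eps multiN : core.

Section Head.
Variables (f : T) (mf : multi f).
Lemma multi_headL c x y s : f ((c *: x + y) :: s) = c *: f (x :: s) + f (y :: s).
Proof. exact: multi_lin mf [::] _ _ _ _. Qed.
Lemma multi_headD x y s : f ((x + y) :: s) = f (x :: s) + f (y :: s).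
Proof. by have := multi_headL 1 x y s; rewrite !scale1r. Qed.
Lemma multi_head0 s : f (0 :: s) = 0.
Proof. by apply: (addrI (f (0 :: s))); rewrite -multi_headD addr0 [RHS]addr0. Qed.
Lemma multi_headN x s : f (- x :: s) = - f (x :: s).
Proof. by apply: (addrI (f (x :: s))); rewrite -multi_headD !subrr multi_head0. Qed.
Lemma multi_headM x y s : f (x * y :: s) = x * f (y :: s) + f (x :: s) * y.
Proof. exact: multi_der mf [::] _ _ _. Qed.
Lemma multi_head1 s : f (1 :: s) = 0.
Proof.
apply: (addrI (f (1 :: s))); rewrite -{2}[1]mulr1.
by have := multi_headM 1 1 s; rewrite !mulr1 mul1r => <-; rewrite addr0.
Qed.
Lemma multi_headC x y s : f (x :: y :: s) = - f (y :: x :: s).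
Proof. exact: multi_swap mf [::] _ _ _. Qed.
Lemma multi_snd0 x s : f (x :: 0 :: s) = 0.
Proof. by rewrite multi_headC multi_head0 oppr0. Qed.
End Head.

Lemma ctr_add x f g : ctr x (f + g) = ctr x f + ctr x g.
Proof. by apply/funext => s; rewrite /ctr !funD. Qed.
Lemma eps_add f g : eps (f + g) = eps f + eps g.
Proof. by apply/funext => s; rewrite /eps !funE mulrDr. Qed.

(** Additivity in one argument rests on linearity of the other, since in degree zero the value of
    each is fed to the other. *)
Lemma schoutenDl f g h : multi h ->
  schouten (f + g) h = schouten f h + schouten g h.
Proof.
move=> mh; apply/funext => s; move: mh; elim: s f g h => [|x s IH] f g h mh.
  by rewrite !funE /= !funE multi_headD//; ring.
rewrite funD /= ctr_add eps_add !IH; auto; rewrite !funE; ring.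
Qed.

Lemma schoutenDr f g h : multi h ->
  schouten h (f + g) = schouten h f + schouten h g.
Proof.
move=> mh; apply/funext => s; move: mh; elim: s f g h => [|x s IH] f g h mh.
  by rewrite !funE /= !funE multi_headD//; ring.
rewrite funD /= ctr_add !IH; auto; rewrite !funE; ring.
Qed.

Lemma schoutenNl f h : multi h ->
  schouten (- f) h = - schouten f h.
Proof.
move=> mh; apply/funext => s; move: mh; elim: s f h => [|x s IH] f h mh.
  by rewrite !funE /= !funE multi_headN//; ring.
rewrite funN /= ctrN epsN !IH; auto; rewrite !funE; ring.
Qed.

Lemma schoutenNr f h : multi h ->
  schouten h (- f) = - schouten h f.
Proof.
move=> mh; apply/funext => s; move: mh; elim: s f h => [|x s IH] f h mh.
  by rewrite !funE /= !funE multi_headN//; ring.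
rewrite funN /= ctrN !IH; auto; rewrite !funE; ring.
Qed.

Definition schoutenE := (schoutenDl, schoutenDr, schoutenNl, schoutenNr).

(** The sign reflects that the bracket has degree -1. *)
Lemma eps_schouten f g : multi f -> multi g ->
  eps (schouten f g) = - schouten (eps f) (eps g).
Proof.
move=> mf mg; apply/funext => s; elim: s f g mf mg => [|x s IH] f g mf mg.
  by rewrite /eps !funE /= expr0 !mul1r expr1; ring.
rewrite ctrE ctr_eps ctr_schouten funN [RHS]funN /= !ctr_eps epsK.
rewrite schoutenNl ?schoutenNr; auto.
rewrite epsE funD !funN mulrDr !mulrN opprD !opprK -[f in X in _ = X]epsK.
have := IH _ _ (multi_ctr x mf) mg; have := IH _ _ (multi_eps mf) (multi_ctr x mg).
by rewrite !funN epsK !epsE => -> ->; ring.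
Qed.

(** In degree zero this is the derivation rule of h at the product of the values of f and g. When g
    and h are both odd, the sign is harmless because g vanishes on the empty list. The sign for
    passing f is carried by [eps f]. *)
Lemma schouten_leibniz b c f g h s : par b g -> par c h ->
  multi f -> multi g -> multi h ->
  schouten (wdg f g) h s =
  (-1) ^+ (b && c) * wdg (schouten f h) g s + wdg (eps f) (schouten g h) s.
Proof.
elim: s b c f g h => [|x s IH] b c f g h gb hc mf mg mh.
  rewrite /= /ctr !epsE /= (multi_headM mh) expr0 !mul1r.
  case: b c gb hc => [] [] gb hc /=; try by ring.
  by rewrite (gb [::] isT); ring.
rewrite ctrE ctr_schouten ctr_wdg eps_wdg !funD !funN schoutenDl// !funD.
rewrite (IH _ _ _ _ _ gb hc (multi_ctr x mf) mg mh).
rewrite (IH _ _ _ _ _ (par_ctr x gb) hc (multi_eps mf) (multi_ctr x mg) mh).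
rewrite (IH _ _ _ _ _ (par_eps gb) (par_ctr x hc) (multi_eps mf) (multi_eps mg)
  (multi_ctr x mh)).
rewrite /= !ctr_schouten ctr_eps epsK (eps_schouten mf mh) (eps_parity gb) (eps_parity hc).
by case: b c gb hc => [] [] gb hc /=; rewrite !wdgE ?schoutenE ?wdgE;
  first [by auto | ring].
Qed.

(* The sign of the last term is kept on g, since schouten g (schouten f h) is
   only additive in g once schouten f h is known to be linear. *)
Lemma schouten_jacobi a b c f g h s : par a f -> par b g -> par c h ->
  multi f -> multi g -> multi h ->
  schouten (eps f) (schouten g h) s =
  - schouten (schouten f g) h s
  - schouten (if a then g else eps g) (schouten f h) s.
Proof.
elim: s a b c f g h => [|x s IH] a b c f g h fa gb hc mf mg mh.
  (* Only lists of length at most two occur. An odd function vanishes on lengths zero and two, an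
     even one on length one; this reconciles the signs in each of the eight parity patterns. *)
  have low (d : bool) (k : T) : par d k ->
      if d then k [::] = 0 /\ (forall y z, k [:: y; z] = 0) else forall y, k [:: y] = 0.
    by case: d => kd; [split; move=> *; exact: kd|move=> *; exact: kd].
  move: (low _ _ fa) (low _ _ gb) (low _ _ hc).
  case: a b c {fa gb hc low} => [] [] [] /= => [[f0 f2]|[f0 f2]|[f0 f2]|[f0 f2]|f1|f1|f1|f1]
    => [[g0 g2]|[g0 g2]|g1|g1|[g0 g2]|[g0 g2]|g1|g1]
    => [[h0 h2]|h1|[h0 h2]|h1|[h0 h2]|h1|[h0 h2]|h1];
  rewrite /= ?epsE /= /ctr ?(multi_headD mf, multi_headD mg, multi_headD mh,
    multi_headN mf, multi_headN mg, multi_headN mh) ?epsE /= ?expr0 ?mul1r;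
  rewrite ?(multi_headC mg (h [::])) ?(multi_headC mf (h [::])) ?(multi_headC mh (g [::]));
  repeat match goal with
    | H : _ = 0 |- _ => rewrite ?H; clear H
    | H : forall y, @?P y = 0 |- _ => rewrite ?H; clear H
    | H : forall y z, @?P y z = 0 |- _ => rewrite ?H; clear H
  end; rewrite ?(multi_head0 mf, multi_head0 mg, multi_head0 mh)
    ?(multi_snd0 mf, multi_snd0 mg, multi_snd0 mh); try ring.
(* The minus sign makes [eps] of this function equal to [ctr x (eps f)], which is what occurs in the
   goal. *)
have IH1 := IH _ _ _ _ _ _ (par_opp (par_ctr x fa)) gb hc (multiN (multi_ctr x mf)) mg mh.
have IH3 := IH _ _ _ _ _ _ (par_eps fa) (par_eps gb) (par_ctr x hc)
  (multi_eps mf) (multi_eps mg) (multi_ctr x mh).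
have E k l : schouten k l (x :: s) =
  - schouten (ctr x k) l s - schouten (eps k) (ctr x l) s by [].
rewrite epsN -ctr_eps in IH1; rewrite epsK in IH3.
rewrite !E !ctr_schouten !eps_schouten //.
(* The sign is chosen so that the last term of the induction hypothesis contains the contraction of
   [if a then g else eps g]. *)
have pg : par (~~ b) (if a then ctr x g else - ctr x g).
  by case: (a); [|apply: par_opp]; apply: par_ctr.
have mg' : multi (if a then ctr x g else - ctr x g) by case: (a); auto.
have := IH _ _ _ _ _ _ (par_eps fa) pg hc (multi_eps mf) mg' mh; move: IH1 IH3.
rewrite !epsK (eps_parity fa).
case: (a) => /=; rewrite ?epsN -?ctr_eps ?epsK => IH1 IH3 IH2;
  rewrite ?funE IH1;
  do ?[rewrite schoutenE in IH2; last by auto];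
  do ?[rewrite schoutenE in IH3; last by auto];
  do ?[rewrite schoutenE; last by auto];
  rewrite ?funE in IH2 IH3 *; rewrite ?IH2 ?IH3; ring.
Qed.
End Contraction.

(** * Poisson differential and divergence *)

#[local] Hint Resolve multi_ctr multi_eps multiN : core.

Section PoissonDifferential.
Variables (K : fieldType) (S : comAlgType K) (pi : poisson_bracket S).
Local Notation T := (seq S -> S).
Implicit Types (f g h : T) (s : seq S) (x y z : S).

(* The Lie derivative L_x, defined by the value of [L_x, i_y], and the Poisson
   differential, defined by Cartan's formula (see ctr_poisson_d). *)
Fixpoint lie x f s : S :=
  if s is y :: s' then lie x (ctr y f) s' - f (pi x y :: s') else pi x (f [::]).

Fixpoint poisson_d f s : S :=
  if s is x :: s' then lie x f s' - poisson_d (ctr x f) s' else 0.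

Lemma ctr_lie x y f : ctr y (lie x f) = lie x (ctr y f) - ctr (pi x y) f.
Proof. by []. Qed.
Lemma ctr_poisson_d x f : ctr x (poisson_d f) = lie x f - poisson_d (ctr x f).
Proof. by []. Qed.

Lemma pbDr x y z : pi x (y + z) = pi x y + pi x z.
Proof. by have := pb_linr pi 1 y z x; rewrite !scale1r. Qed.
Lemma pb0r x : pi x 0 = 0.
Proof. by apply: (addrI (pi x 0)); rewrite -pbDr addr0 [RHS]addr0. Qed.

Lemma lieD x f g : lie x (f + g) = lie x f + lie x g.
Proof.
apply/funext => s; elim: s f g => [|y s IH] f g; first by rewrite !funE /= pbDr.
by rewrite !funE /= ctr_add IH !funE; ring.
Qed.

Lemma lie0 x : lie x 0 = 0.
Proof. by apply: (addrI (lie x 0)); rewrite -lieD addr0 [RHS]addr0. Qed.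
Lemma lieN x f : lie x (- f) = - lie x f.
Proof. by apply: (addrI (lie x f)); rewrite -lieD !subrr lie0. Qed.

Lemma lie_eps x f : lie x (eps f) = eps (lie x f).
Proof.
apply/funext => s; elim: s f => [|y s IH] f; first by rewrite /= !epsE /= ?expr0 !mul1r.
rewrite /= ctr_eps lieN funN IH !epsE /= exprS; ring.
Qed.

Lemma lie_wdg x f g : lie x (wdg f g) = wdg (lie x f) g + wdg f (lie x g).
Proof.
apply/funext => s; elim: s f g => [|y s IH] f g.
  by rewrite funD /= pb_derr addrC.
rewrite [LHS]/= ctr_wdg lieD !funE !IH /= !ctr_lie -lie_eps.
by rewrite !wdgE !funE; ring.
Qed.

Lemma poisson_dD f g : poisson_d (f + g) = poisson_d f + poisson_d g.
Proof.
apply/funext => s; elim: s f g => [|y s IH] f g; first by rewrite funD /= addr0.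
by rewrite !funE /= ctr_add IH lieD !funE; ring.
Qed.
Lemma poisson_d0 : poisson_d 0 = 0.
Proof. by apply: (addrI (poisson_d 0)); rewrite -poisson_dD addr0 [RHS]addr0. Qed.
Lemma poisson_dN f : poisson_d (- f) = - poisson_d f.
Proof. by apply: (addrI (poisson_d f)); rewrite -poisson_dD !subrr poisson_d0. Qed.

Lemma poisson_d_eps f : poisson_d (eps f) = - eps (poisson_d f).
Proof.
apply/funext => s; elim: s f => [|x s IH] f; first by rewrite funN epsE /= mulr0 oppr0.
by rewrite /= ctr_eps poisson_dN !funN IH lie_eps !funN !epsE /= exprS; ring.
Qed.

(** Contractions and Lie derivatives are derivations of the product, and Cartan's formula passes
    this on to the differential. In degree zero both sides vanish. *)
Lemma poisson_d_wdg f g :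
  poisson_d (wdg f g) = wdg (poisson_d f) g + wdg (eps f) (poisson_d g).
Proof.
apply/funext => s; elim: s f g => [|x s IH] f g.
  by rewrite funD /= mul0r mulr0 addr0.
rewrite [LHS]/= ctr_wdg poisson_dD lie_wdg !funE !IH !funE poisson_d_eps.
by rewrite /= !ctr_poisson_d ctr_eps !epsK !wdgE; ring.
Qed.

End PoissonDifferential.

Section DeltaList.
Variables (K : fieldType) (S : comAlgType K) (F : frobenius_iso S).
Local Notation T := (seq S -> S).
Implicit Types (f g h : T) (s : seq S) (x y z : S).

Local Notation frob1 a := (frob_form F a 1).

Lemma frob_form1 a b : frob_form F a b = frob1 (a * b).
Proof. by rewrite [a * b]mulrC frob_formMl mulr1 frob_formC. Qed.

(* Delta on list functions. The sign in the definition of Delta is absorbed by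
   putting the extra argument first. Junk unless f is divergible. *)
Definition div f : T := fun s =>
  xget 0 [set b | forall x, frob_form F b x = frob1 (f (x :: s))].

(* Products and differentials of multi functions are not shown to be multi again:
   this weaker condition is all that div needs. *)
Record divergible f : Prop := {
  divergible_lin : forall c x y s,
    f ((c *: x + y) :: s) = c *: f (x :: s) + f (y :: s);
  divergible_swap : forall x y s, f (x :: y :: s) = - f (y :: x :: s)
}.

Lemma divergible_multi f : multi f -> divergible f.
Proof. by move=> mf; split=> *; [apply: multi_headL|apply: multi_headC]. Qed.

Lemma frob1Z c a : frob1 (c *: a) = c * frob1 a.
Proof. exact: frob_formZl. Qed.
Lemma frob1D a b : frob1 (a + b) = frob1 a + frob1 b.
Proof. exact: frob_formDl. Qed.
Lemma frob1N a : frob1 (- a) = - frob1 a.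
Proof. by rewrite -scaleN1r frob1Z mulN1r. Qed.
Lemma frob1_inj a b : (forall x, frob1 (x * a) = frob1 (x * b)) -> a = b.
Proof.
by move=> h; apply: (frob_form_nondeg (F := F)) => x;
  rewrite [LHS]frob_form1 [RHS]frob_form1 mulrC h mulrC.
Qed.

(** The linear functional sending x to [frob1 (f (x :: s))] is represented by an element of S
    because the Frobenius map is onto the dual. *)
Lemma div_spec f s x : divergible f -> frob1 (x * div f s) = frob1 (f (x :: s)).
Proof.
move=> [f1 _]; pose k x : K^o := frob1 (f (x :: s)).
have k_lin : linear k by move=> c y z; rewrite /k f1 frob1D frob1Z.
pose kl := GRing.isLinear.Build K S K^o _ k k_lin.
pose g : {scalar S} := HB.pack k kl.
have [b hb] := frob_surj F g.
have hex : exists b, forall x, frob_form F b x = frob1 (f (x :: s)).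
  by exists b => z; rewrite frob_formC -[RHS]/(g z) -hb.
by rewrite mulrC -frob_form1; move: x; exact: (xgetPex (0 : S) hex).
Qed.

Lemma divP f s b : divergible f ->
  (forall x, frob1 (x * b) = frob1 (f (x :: s))) -> div f s = b.
Proof. by move=> df h; apply: frob1_inj => x; rewrite div_spec// h. Qed.

Lemma divergibleD f g : divergible f -> divergible g -> divergible (f + g).
Proof.
move=> [f1 f2] [g1 g2]; split=> *; rewrite !funD.
  by rewrite f1 g1 scalerDr addrACA.
by rewrite f2 g2 opprD.
Qed.
Lemma divergibleN f : divergible f -> divergible (- f).
Proof.
move=> [f1 f2]; split=> *; rewrite !funN; first by rewrite f1 opprD scalerN.
by rewrite f2.
Qed.

Lemma divD f g : divergible f -> divergible g -> div (f + g) = div f + div g.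
Proof.
move=> df dg; apply/funext => s; apply: divP; first exact: divergibleD.
by move=> x; rewrite !funD mulrDr !frob1D !div_spec.
Qed.
Lemma divN f : divergible f -> div (- f) = - div f.
Proof.
move=> df; apply/funext => s; apply: divP; first exact: divergibleN.
by move=> x; rewrite !funN mulrN !frob1N !div_spec.
Qed.
Lemma divZ (c : K) f : divergible f -> div (fun s => c *: f s) = fun s => c *: div f s.
Proof.
move=> df; apply/funext => s; apply: divP.
  case: df => f1 f2; split=> *; last by rewrite f2 scalerN.
  by rewrite f1 scalerDr !scalerA mulrC.
by move=> x; rewrite -scalerAr !frob1Z !div_spec.
Qed.

(** The sign comes from exchanging x with the argument that [div] puts first. *)
Lemma ctr_div x f : (forall y, divergible (ctr y f)) -> divergible f ->
  ctr x (div f) = - div (ctr x f).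
Proof.
move=> dcf df; apply/funext => s; rewrite funN /ctr; apply: divP => // y.
by rewrite mulrN frob1N (div_spec _ _ (dcf x)) (divergible_swap df) frob1N.
Qed.

End DeltaList.

(** * Divergence of products and of coboundaries *)

Section Divergence.
Variables (K : fieldType) (S : comAlgType K) (F : frobenius_iso S).
Local Notation T := (seq S -> S).
Implicit Types (f g h : T) (s : seq S) (x y z : S).
Local Notation frob1 a := (frob_form F a 1).
Local Notation div := (div F).

(** The scalar is moved into S, where [wdg_linl] and [wdg_linr] accept it. *)
Lemma ctr_lin c x y f : multi f ->
  ctr (c *: x + y) f = fun t => c%:A * ctr x f t + ctr y f t.
Proof. by move=> mf; apply/funext => t; rewrite /ctr multi_headL// mulr_algl. Qed.

Lemma ctrC x y f : multi f -> ctr x (ctr y f) = - ctr y (ctr x f).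
Proof. by move=> mf; apply/funext => t; rewrite /ctr multi_headC. Qed.

Lemma divergible_wdg f g : multi f -> multi g -> divergible (wdg f g).
Proof.
move=> mf mg; split=> [c x y s|x y s].
  by rewrite /= !ctr_lin// wdg_linl wdg_linr !mulr_algl scalerDr addrACA.
rewrite /= !ctr_eps !wdgE !(ctrC x y)//.
by rewrite !wdgE; ring.
Qed.

Lemma divergible_div f : multi f -> divergible (div f).
Proof.
move=> mf; have df := divergible_multi mf; split=> [c x y s|x y s].
  apply: divP => // z. rewrite mulrDr -scalerAr frob1D frob1Z !div_spec//.
  by rewrite (multi_lin mf [:: z]) frob1D frob1Z.
by apply: divP => // z; rewrite mulrN frob1N div_spec// (multi_swap mf [:: z]) frob1N opprK.
Qed.

Lemma ctr_div_multi x f : multi f -> ctr x (div f) = - div (ctr x f).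
Proof. by move=> mf; apply: ctr_div => *; apply: divergible_multi; auto. Qed.

(** In degree zero this is the vanishing of a derivation at 1: [frob1 (div f [:: x])] is the pairing
    of [div f [:: x]] with 1, hence [frob1 (f [:: 1; x])]. *)
Lemma div_div f : multi f -> div (div f) = 0.
Proof.
move=> mf; apply/funext => s; elim: s f mf => [|x s IH] f mf.
  apply: divP => [|x]; first exact: divergible_div.
  rewrite mulr0 -[div f [:: x]]mul1r div_spec; last exact: divergible_multi.
  by rewrite multi_head1.
have dc y : divergible (div (ctr y f)) by apply: divergible_div; auto.
have dcd y : divergible (ctr y (div f)).
  by rewrite ctr_div_multi//; apply: divergibleN.
rewrite -[LHS]/(ctr x (div (div f)) s) (ctr_div F x dcd (divergible_div mf)).
by rewrite ctr_div_multi// divN// opprK IH; auto.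
Qed.

Lemma eps_div f : multi f -> eps (div f) = - div (eps f).
Proof.
move=> mf; suff -> : div (eps f) = - eps (div f) by rewrite opprK.
have df := divergible_multi mf; apply/funext => s; apply: divP => [|x].
  by apply: divergible_multi; auto.
have E a : frob1 ((-1) ^+ size s * a) = (-1) ^+ size s * frob1 a.
  by rewrite -[in LHS]signr_odd -[in RHS]signr_odd; case: (odd _);
    rewrite ?mul1r// !mulN1r frob1N.
rewrite funN !epsE /= exprS mulN1r mulNr mulrN !frob1N mulrCA !E.
by rewrite div_spec.
Qed.

(** The bracket arises in degree zero: pairing [div f [::]] with [x * g [::]] expands f at a
    product, and the derivation rule leaves, besides the expected term, x times the value of f at [g
    [::]]. The same happens with f and g exchanged. *)
Lemma div_wdg f g : multi f -> multi g ->
  div (wdg f g) = wdg (div f) g + wdg (eps f) (div g) + schouten f g.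
Proof.
move=> mf mg; apply/funext => s; elim: s f g mf mg => [|x s IH] f g mf mg.
  apply: divP => [|x]; first exact: divergible_wdg.
  have df := divergible_multi mf; have dg := divergible_multi mg.
  have Ef := div_spec F [::] (x * g [::]) df.
  have Eg := div_spec F [::] (x * f [::]) dg.
  rewrite (multi_headM mf) frob1D in Ef; rewrite (multi_headM mg) frob1D in Eg.
  rewrite !funD /= !epsE expr0 !mul1r !mulrDr !mulrN !frob1D !frob1N /ctr.
  have -> : x * (div f [::] * g [::]) = x * g [::] * div f [::] by ring.
  have -> : x * (f [::] * div g [::]) = x * f [::] * div g [::] by ring.
  rewrite Ef Eg -!frob1N -!frob1D.
  by congr (frob_form F); ring.
have dc y : divergible (ctr y (wdg f g)).
  by rewrite ctr_wdg; apply: divergibleD; apply: divergible_wdg; auto.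
rewrite -[LHS]/(ctr x (div (wdg f g)) s) (ctr_div F x dc (divergible_wdg mf mg)).
rewrite ctr_wdg divD; [|by apply: divergible_wdg; auto..].
rewrite !funE !IH; auto.
rewrite !funE /= !ctr_div_multi// eps_div// !ctr_eps !epsK !wdgE.
by ring.
Qed.

(** * Lie derivative and Poisson differential when the form kills brackets *)

Section Unimodular.
Variable pi : poisson_bracket S.
Hypothesis uni : forall x y, frob1 (pi x y) = 0.

(** Integration by parts: the functional kills the bracket of y with a product. *)
Lemma frob1_pb x y z : frob1 (x * pi y z) = - frob1 (pi y x * z).
Proof. by apply/eqP; rewrite -addr_eq0 -frob1D -pb_derr uni. Qed.

Lemma multi_lieZ c x y f : multi f -> forall s,
  lie pi (c *: x + y) f s = c *: lie pi x f s + lie pi y f s.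
Proof.
move=> mf s; elim: s f mf => [|z s IH] f mf /=; first by rewrite pb_linl.
rewrite IH; last by auto.
by rewrite pb_linl multi_headL// scalerBr opprD addrACA.
Qed.

(** Scalars lie in K here: unlike the product, the Lie derivative is not linear over S. *)
Lemma lieZ c x f s : lie pi x (fun t => c *: f t) s = c *: lie pi x f s.
Proof.
elim: s f => [|z s IH] f /=.
  by rewrite -[c *: f _]addr0 pb_linr pb0r addr0.
by rewrite (IH (ctr z f)) scalerBr.
Qed.

Lemma divergible_lie x f : multi f -> divergible (lie pi x f).
Proof.
move=> mf; split=> [c y z s|y z s] /=.
  rewrite ctr_lin// (_ : (fun t => _) = (fun t => c *: ctr y f t) + ctr z f).
    rewrite lieD funD lieZ pb_linr multi_headL//.
    by rewrite scalerBr opprD addrACA.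
  by apply/funext => t; rewrite funD mulr_algl.
by rewrite ctrC// lieN funN /ctr !(multi_headC mf y, multi_headC mf (pi x y)); ring.
Qed.

Lemma poisson_dZ c f s : poisson_d pi (fun t => c *: f t) s = c *: poisson_d pi f s.
Proof.
elim: s f => [|z s IH] f /=; first by rewrite scaler0.
by rewrite (IH (ctr z f)) lieZ scalerBr.
Qed.

Lemma divergible_poisson_d f : multi f -> divergible (poisson_d pi f).
Proof.
move=> mf; split=> [c y z s|y z s] /=.
  rewrite multi_lieZ// ctr_lin//.
  rewrite (_ : (fun t => _) = (fun t => c *: ctr y f t) + ctr z f).
    by rewrite poisson_dD funD poisson_dZ scalerBr opprD addrACA.
  by apply/funext => t; rewrite funD mulr_algl.
by rewrite (ctrC z y)// poisson_dN funN (pb_skew _ z y) multi_headN//; ring.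
Qed.

(** In degree zero, integration by parts moves the bracket with x onto the test element y. What
    remains is f at the bracket of x and y, the correction term in the Lie derivative; its other
    term is a bracket and is killed. *)
Lemma div_lie x f : multi f -> div (lie pi x f) = lie pi x (div f).
Proof.
move=> mf; apply/funext => s; elim: s f mf => [|y s IH] f mf.
  apply: divP => [|y]; first exact: divergible_lie.
  rewrite /= frob1_pb div_spec ?uni; last exact: divergible_multi.
  by rewrite frob1D frob1N uni add0r.
have dc z : divergible (ctr z (lie pi x f)).
  by rewrite ctr_lie; apply: divergibleD;
    [apply: divergible_lie|apply/divergibleN/divergible_multi]; auto.
rewrite -[LHS]/(ctr y (div (lie pi x f)) s) (ctr_div F y dc (divergible_lie x mf)).
rewrite ctr_lie divD; [|by apply: divergible_lie;
  auto|by apply/divergibleN/divergible_multi; auto].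
rewrite divN; last by apply: divergible_multi; auto.
rewrite -[RHS]/(ctr y (lie pi x (div f)) s) ctr_lie !ctr_div_multi// lieN.
by rewrite !funE IH; auto; ring.
Qed.

Lemma div_poisson_d f : multi f -> div (poisson_d pi f) = - poisson_d pi (div f).
Proof.
move=> mf; apply/funext => s; elim: s f mf => [|x s IH] f mf.
  apply: divP => [|x]; first exact: divergible_poisson_d.
  (* The remaining zero is written as [pi 0 0], so that [uni] also evaluates the functional
     there. *)
  by rewrite funN /= oppr0 mulr0 addr0 uni -(pb0r pi 0) uni.
have dc z : divergible (ctr z (poisson_d pi f)).
  rewrite ctr_poisson_d; apply: divergibleD; first exact: divergible_lie.
  by apply/divergibleN/divergible_poisson_d; auto.
rewrite -[LHS]/(ctr x (div (poisson_d pi f)) s).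
rewrite (ctr_div F x dc (divergible_poisson_d mf)) ctr_poisson_d divD; first last.
- by apply/divergibleN/divergible_poisson_d; auto.
- exact: divergible_lie.
rewrite divN; last by apply: divergible_poisson_d; auto.
rewrite div_lie// !funE IH; last by auto.
rewrite -[poisson_d pi (div f) _]/(ctr x (poisson_d pi (div f)) s) ctr_poisson_d.
by rewrite ctr_div_multi// poisson_dN !funE; ring.
Qed.

End Unimodular.
End Divergence.

(** * Comparison with the wedge product on shuffles *)

Section Links.
Variables (K : fieldType) (S : comAlgType K).
Local Notation T := (seq S -> S).
Local Notation fn n := (('I_n -> S) -> S).

(* The arguments stored in s; indices beyond the end of s give 0. *)
Definition args n (s : seq S) : 'I_n -> S := fun i => s`_i.
Arguments args n s _ : clear implicits.
Definition evn n (P : fn n) : T := fun s => if size s == n then P (args n s) else 0.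
Definition arg_cons n (x : S) (a : 'I_n -> S) : 'I_n.+1 -> S :=
  fun i => if unlift ord0 i is Some j then a j else x.
Definition ctr_fn n (x : S) (P : fn n.+1) : fn n := fun a => P (arg_cons x a).

Lemma arg_cons0 n x (a : 'I_n -> S) : arg_cons x a ord0 = x.
Proof. by rewrite /arg_cons unlift_none. Qed.
Lemma arg_consS n x (a : 'I_n -> S) i : arg_cons x a (lift ord0 i) = a i.
Proof. by rewrite /arg_cons liftK. Qed.

Lemma arg_cons_eq n x (a : 'I_n -> S) b : b ord0 = x -> (forall i, b (lift ord0 i) = a i) ->
  b = arg_cons x a.
Proof.
move=> b0 bS; apply/funext => i.
by case: (unliftP ord0 i) => [j ->|->]; rewrite ?arg_cons0 ?arg_consS.
Qed.

Lemma args_cons n x s : args n.+1 (x :: s) = arg_cons x (args n s).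
Proof. exact: arg_cons_eq. Qed.

Lemma ctr_evn n x (P : fn n.+1) : ctr x (evn P) = evn (ctr_fn x P).
Proof. by apply/funext => s; rewrite /ctr /evn /= eqSS /ctr_fn -args_cons. Qed.

Lemma ctr_evn0 x (P : fn 0) : ctr x (evn P) = 0.
Proof. by []. Qed.

Lemma eps_evn n (P : fn n) : eps (evn P) = fun s => (-1) ^+ n * evn P s.
Proof.
by apply/funext => s; rewrite epsE /evn; case: eqP => [->//|_]; rewrite !mulr0.
Qed.

Section LiftPerm.
Variables (V : nmodType) (n : nat) (i j : 'I_n.+1).

Lemma lift_perm_onto (t : 'S_n.+1) : t i = j -> exists s, t = lift_perm i j s.
Proof.
move=> tij; have tl k : t (lift i k) != j.
  by rewrite -tij (inj_eq perm_inj) eq_sym neq_lift.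
pose u k := odflt k (unlift j (t (lift i k))).
have uE k : lift j (u k) = t (lift i k).
  rewrite /u; case: unliftP (tl k) => [l ->//|->].
  by rewrite eqxx.
have u_inj : injective u.
  by move=> k l kl; apply: (@lift_inj _ i); apply: (@perm_inj _ t); rewrite -!uE kl.
exists (perm u_inj); apply/permP => k.
by case: (unliftP i k) => [l ->|->]; rewrite ?lift_perm_id ?lift_perm_lift ?permE ?uE.
Qed.

Lemma lift_perm_inj : injective (@lift_perm n i j).
Proof.
move=> s t st; apply/permP => k; apply: (@lift_inj _ j).
by rewrite -!(lift_perm_lift i) st.
Qed.

(** Applied with j the smallest index, to delete from a shuffle the position at which it takes its
    smallest value. *)
Lemma sum_lift_perm (P : pred 'S_n.+1) (G : 'S_n.+1 -> V) :
  \sum_(t | P t && (t i == j)) G t =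
  \sum_(s | P (lift_perm i j s)) G (lift_perm i j s).
Proof.
rewrite [RHS](eq_bigl (fun s => s \in [pred s | P (lift_perm i j s)])) //.
rewrite -(big_imset _ (in2W lift_perm_inj)).
apply: eq_bigl => t; apply/andP/imsetP => [[Pt /eqP/lift_perm_onto[s ts]]|[s Ps ->]].
  by exists s => //; rewrite inE -ts.
by rewrite lift_perm_id.
Qed.

End LiftPerm.

(** * Shuffles sorted by the block that contains the smallest value *)

Section ShuffleSplit.

Definition shuffle_sum_pred m n k (e : (m + n)%N = k) (t : 'S_k) :=
  [forall i : 'I_m, forall j : 'I_m, (i < j)%N ==>
    (t (cast_ord e (lshift n i)) < t (cast_ord e (lshift n j)))%N] &&
  [forall i : 'I_n, forall j : 'I_n, (i < j)%N ==>
    (t (cast_ord e (rshift m i)) < t (cast_ord e (rshift m j)))%N].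

Definition shuffle_sum_term m n k (e : (m + n)%N = k) (P : fn m) (Q : fn n) (a : 'I_k -> S)
    (t : 'S_k) : S :=
  (-1) ^+ t * P (fun i => a (t (cast_ord e (lshift n i))))
            * Q (fun j => a (t (cast_ord e (rshift m j)))).

(* The wedge product with the number k of arguments kept separate from m + n, so
   that an argument can be removed from either factor without a cast. *)
Definition shuffle_sum m n k (e : (m + n)%N = k) P Q a :=
  \sum_(t | shuffle_sum_pred e t) shuffle_sum_term e P Q a t.

Lemma shuffle_sum_predP m n k (e : (m + n)%N = k) (t : 'S_k) :
  reflect ((forall i j : 'I_m, (i < j)%N ->
     (t (cast_ord e (lshift n i)) < t (cast_ord e (lshift n j)))%N) /\
   (forall i j : 'I_n, (i < j)%N ->
     (t (cast_ord e (rshift m i)) < t (cast_ord e (rshift m j)))%N)) (shuffle_sum_pred e t).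
Proof.
apply: (iffP andP) => -[h1 h2]; split.
- by move=> i j ij; move/forallP/(_ i)/forallP/(_ j)/implyP: h1; apply.
- by move=> i j ij; move/forallP/(_ i)/forallP/(_ j)/implyP: h2; apply.
- by do 2![apply/forallP => ?]; apply/implyP; apply: h1.
- by do 2![apply/forallP => ?]; apply/implyP; apply: h2.
Qed.

Lemma shuffle_sum_left m n k (e : (m.+1 + n)%N = k.+1) (e' : (m + n)%N = k) P Q a :
  \sum_(t | shuffle_sum_pred e t && (t (cast_ord e (lshift n ord0)) == ord0))
    shuffle_sum_term e P Q a t =
  shuffle_sum e' (ctr_fn (a ord0) P) Q (fun i => a (lift ord0 i)).
Proof.
set p := cast_ord e _.
have pL i : cast_ord e (lshift n (lift ord0 i)) = lift p (cast_ord e' (lshift n i)).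
  exact/val_inj.
have pR i : cast_ord e (rshift m.+1 i) = lift p (cast_ord e' (rshift m i)).
  exact/val_inj.
rewrite sum_lift_perm; apply: eq_big => [s|s _].
  apply/shuffle_sum_predP/shuffle_sum_predP => -[h1 h2]; split=> i j ij.
  - by have := h1 (lift ord0 i) (lift ord0 j) ij; rewrite !pL !lift_perm_lift.
  - by have := h2 i j ij; rewrite !pR !lift_perm_lift.
  - case: (unliftP ord0 j) ij => [j' ->|-> //].
    case: (unliftP ord0 i) => [i' ->|-> _]; rewrite !pL lift_perm_lift.
      by move=> ij; rewrite lift_perm_lift; apply: h1.
    by rewrite lift_perm_id.
  - by rewrite !pR !lift_perm_lift; apply: h2.
rewrite /shuffle_sum_term odd_lift_perm /=; congr (_ * P _ * Q _).
  by apply: arg_cons_eq => [|i]; rewrite ?lift_perm_id// pL lift_perm_lift.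
by apply/funext => i; rewrite pR lift_perm_lift.
Qed.

(** Here the value 0 is taken at position m, and deleting both costs the sign [(-1) ^+ m]. It is the
    sign that [eps] contributes in the recursion of [wdg]. *)
Lemma shuffle_sum_right m n k (e : (m + n.+1)%N = k.+1) (e' : (m + n)%N = k) P Q a :
  \sum_(t | shuffle_sum_pred e t && (t (cast_ord e (rshift m ord0)) == ord0))
    shuffle_sum_term e P Q a t =
  (-1) ^+ m * shuffle_sum e' P (ctr_fn (a ord0) Q) (fun i => a (lift ord0 i)).
Proof.
set p := cast_ord e _; have vp : p = m :> nat by rewrite /= addn0.
have p0 : cast_ord e (rshift m ord0) = p by [].
clearbody p.
have pR i : cast_ord e (rshift m (lift ord0 i)) = lift p (cast_ord e' (rshift m i)).
  by apply/val_inj; rewrite /= /bump vp leq_addr addnCA.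
have pL i : cast_ord e (lshift n.+1 i) = lift p (cast_ord e' (lshift n i)).
  by apply/val_inj; rewrite /= /bump vp leqNgt ltn_ord.
rewrite sum_lift_perm mulr_sumr; apply: eq_big => [s|s _].
  apply/shuffle_sum_predP/shuffle_sum_predP => -[h1 h2]; split=> i j ij.
  - by have := h1 i j ij; rewrite !pL !lift_perm_lift.
  - by have := h2 (lift ord0 i) (lift ord0 j) ij; rewrite !pR !lift_perm_lift.
  - by rewrite !pL !lift_perm_lift; apply: h1.
  - case: (unliftP ord0 j) ij => [j' ->|-> //].
    case: (unliftP ord0 i) => [i' ->|-> _]; rewrite !pR lift_perm_lift.
      by move=> ij; rewrite lift_perm_lift; apply: h2.
    by rewrite p0 lift_perm_id.
rewrite /shuffle_sum_term odd_lift_perm vp addbF signr_addb signr_odd -!mulrA.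
congr (_ * (_ * (P _ * Q _))).
  by apply/funext => i; rewrite pL lift_perm_lift.
by apply: arg_cons_eq => [|i]; rewrite ?p0 ?lift_perm_id// pR lift_perm_lift.
Qed.

(** Both blocks are increasing, so the smallest value can only open one of them. *)
Lemma shuffle_sum_pred_first m n k (e : (m + n)%N = k.+1) (t : 'S_k.+1) :
  shuffle_sum_pred e t ->
  (exists2 i : 'I_m, i = 0%N :> nat & t (cast_ord e (lshift n i)) = ord0) \/
  (exists2 i : 'I_n, i = 0%N :> nat & t (cast_ord e (rshift m i)) = ord0).
Proof.
case/shuffle_sum_predP => h1 h2; pose q := cast_ord (esym e) ((t^-1)%g ord0).
have tq : t (cast_ord e q) = ord0 by rewrite cast_ordKV permKV.
case: (split_ordP q) => -[[|i] im] qE; rewrite qE in tq.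
- by left; exists (Ordinal im).
- have := h1 (Ordinal (ltn_trans (ltn0Sn i) im)) (Ordinal im) isT.
  by rewrite tq.
- by right; exists (Ordinal im).
- have := h2 (Ordinal (ltn_trans (ltn0Sn i) im)) (Ordinal im) isT.
  by rewrite tq.
Qed.

(** The two terms in the recursion of [wdg] are the shuffles whose value 0 opens the left block and
    those where it opens the right one. *)
Lemma wdg_shuffle_sum s m n k (e : (m + n)%N = k) (P : fn m) (Q : fn n) : size s = k ->
  wdg (evn P) (evn Q) s = shuffle_sum e P Q (args k s).
Proof.
elim: s m n k e P Q => [|x s IH] m n k e P Q; first move=> /= k0;
  last case: k e => // k e [sk].
  move: e; rewrite -k0 => e;
    have [m0 n0] : m = 0%N /\ n = 0%N by case: m n {P Q} e => [|?] [].
  move: P Q e; rewrite m0 n0 => P Q e; rewrite /shuffle_sum (big_pred1 (1%g : 'S_0)).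
    rewrite /shuffle_sum_term odd_perm1 mul1r /evn /=.
    by congr (P _ * Q _); apply/funext => -[].
  move=> t; have -> : t = (1%g : 'S_0) by apply/permP => -[].
  by rewrite /= eqxx; apply/shuffle_sum_predP; split=> -[].
have E0 : args k.+1 (x :: s) ord0 = x by [].
have ES : (fun i => args k.+1 (x :: s) (lift ord0 i)) = args k s by apply/funext.
case: m n e P Q => [|m] [|n] e P Q //=; rewrite eps_evn ?ctr_evn ?ctr_evn0 wdgMl.
(* With no argument for P, the value 0 can only open the right block. *)
- have e' : (0 + n)%N = k by case: e.
  rewrite wdg0l add0r (IH _ _ _ e')// -{1}E0 -ES -shuffle_sum_right; apply: eq_bigl => t.
  apply/andP/idP => [[]//|ht]; split=> //;
    have [[[]//]|[i i0 <-]] := shuffle_sum_pred_first ht.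
  by apply/eqP; congr (t (cast_ord e (rshift _ _))); apply/val_inj.
- have e' : (m + 0)%N = k by case: e.
  rewrite wdg0r mulr0 addr0 (IH _ _ _ e')// -{1}E0 -ES -shuffle_sum_left;
    apply: eq_bigl => t.
  apply/andP/idP => [[]//|ht]; split=> //;
    have [[i i0 <-]|[[]//]] := shuffle_sum_pred_first ht.
  by apply/eqP; congr (t (cast_ord e (lshift _ _))); apply/val_inj.
- have e1 : (m + n.+1)%N = k by case: e.
  have e2 : (m.+1 + n)%N = k by case: e => <-; rewrite addnS.
  rewrite (IH _ _ _ e1)// (IH _ _ _ e2)//.
  rewrite [RHS](bigID (fun t : 'S_k.+1 => t (cast_ord e (lshift n.+1 ord0)) == ord0)) /=.
  rewrite (shuffle_sum_left e e1); congr (_ + _); apply/esym.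
  rewrite (eq_bigl (fun t : 'S_k.+1 =>
    shuffle_sum_pred e t && (t (cast_ord e (rshift m.+1 ord0)) == ord0))).
    exact: (shuffle_sum_right e e2).
  move=> t; apply/andP/andP => -[ht /eqP t0]; split=> //.
    have [[i i0 ti]|[i i0 <-]] := shuffle_sum_pred_first ht.
      by case: t0; rewrite -ti; congr (t (cast_ord e (lshift _ _))); apply/val_inj.
    by apply/eqP; congr (t (cast_ord e (rshift _ _))); apply/val_inj.
  by rewrite -t0 (inj_eq perm_inj) (inj_eq (@cast_ord_inj _ _ _)) eq_lrshift.
Qed.

Lemma wdg_evn m n (P : fn m) (Q : fn n) :
  wdg (evn P) (evn Q) = evn (wedge_fun P Q).
Proof.
apply/funext => s; rewrite /evn; case: eqP => [smn|smn].
  rewrite -/(evn P) -/(evn Q) (wdg_shuffle_sum (erefl (m + n)%N))// /shuffle_sum /wedge_fun.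
  have cE (i : 'I_(m + n)) : cast_ord (erefl (m + n)%N) i = i by apply/val_inj.
  apply: eq_big => [t|t _].
    apply/shuffle_sum_predP/andP => -[h1 h2]; split.
    - by do 2![apply/forallP => ?]; apply/implyP => /h1; rewrite !cE.
    - by do 2![apply/forallP => ?]; apply/implyP => /h2; rewrite !cE.
    - by move=> i j ij; rewrite !cE; move/forallP/(_ i)/forallP/(_ j)/implyP: h1; apply.
    - by move=> i j ij; rewrite !cE; move/forallP/(_ i)/forallP/(_ j)/implyP: h2; apply.
  by rewrite /shuffle_sum_term; congr (_ * P _ * Q _); apply/funext => i; rewrite cE.
(* On lists of any other length the product vanishes too, by following the recursion down to the
   empty list. *)
rewrite -/(evn P) -/(evn Q).
elim: s m n P Q smn => [|x s IH] m n P Q smn.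
  by case: m n P Q smn => [|m] [|n] P Q //= _; rewrite /evn /= ?mul0r ?mulr0.
case: m n P Q smn => [|m] [|n] P Q smn; rewrite /= eps_evn ?ctr_evn ?ctr_evn0 wdgMl.
- by rewrite wdg0l wdg0r mulr0 addr0.
- by rewrite wdg0l IH ?mulr0 ?addr0 // => h; apply: smn; rewrite /= h.
- by rewrite wdg0r IH ?mulr0 ?addr0 // => h; apply: smn; rewrite /= h.
- rewrite !IH ?mulr0 ?addr0 // => h; apply: smn; rewrite /= h ?addnS ?addSn //.
Qed.

End ShuffleSplit.
End Links.
Arguments args {K S} n s _.

(** * Comparison with Delta and the Poisson differential *)

Section MultiLinks.
Variables (K : fieldType) (S : comAlgType K).
Local Notation T := (seq S -> S).
Local Notation fn n := (('I_n -> S) -> S).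

Lemma args_upd n p (z : S) s : size (p ++ z :: s) = n ->
  exists i : 'I_n, forall z', args n (p ++ z' :: s) = upd (args n (p ++ z :: s)) i z'.
Proof.
rewrite size_cat /= => h; have pn : (size p < n)%N by rewrite -h addnS ltnS leq_addr.
exists (Ordinal pn) => z'; apply/funext => j; rewrite /upd /args -val_eqE /=.
by rewrite !nth_cat; case: ltngtP => // jp; rewrite ?jp ?subnn//;
  case: (j - _)%N (subn_gt0 (size p) j) => //; rewrite jp.
Qed.

Lemma args_swap n p (x y : S) s : size (p ++ x :: y :: s) = n ->
  exists2 t : 'S_n, t = true :> bool & args n (p ++ x :: y :: s) =
    args n (p ++ y :: x :: s) \o t.
Proof.
rewrite size_cat /= => h.
have pn : (size p < n)%N by rewrite -h addnS ltnS leq_addr.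
have pn1 : ((size p).+1 < n)%N by rewrite -h !addnS !ltnS leq_addr.
exists (tperm (Ordinal pn) (Ordinal pn1)).
  by rewrite odd_tperm -val_eqE /= neq_ltn ltnSn.
apply/funext => j; rewrite /args /=; case: tpermP => [->|->|]; rewrite /= ?nth_cat.
- by rewrite ltnn subnn ltnNge leqnSn subSnn.
- by rewrite ltnn subnn ltnNge leqnSn subSnn.
move=> /eqP; rewrite -val_eqE /= => jp /eqP; rewrite -val_eqE /= => jp1.
case: ltnP => // pj; have := subnKC pj.
case: (j - size p)%N => [|[|d]] // E; first by case/eqP: jp; rewrite -E addn0.
by case/eqP: jp1; rewrite -E addn1.
Qed.

Lemma multi_evn n (P : fn n) : is_multider P -> multi (evn P).
Proof.
case=> P1 P2 P3; split=> [p c x y s|p x y s|p x y s]; rewrite /evn !size_cat /=.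
- case: eqP => [h|_]; last by rewrite scaler0 addr0.
  have [|i E] := @args_upd n p 0 s; first by rewrite size_cat.
  by rewrite (E (c *: x + y)) (E x) (E y) P1.
- case: eqP => [h|_]; last by rewrite mulr0 mul0r addr0.
  have [|i E] := @args_upd n p 0 s; first by rewrite size_cat.
  by rewrite (E (x * y)) (E x) (E y) P2.
- case: eqP => [h|_]; last by rewrite oppr0.
  have [|t t1 ->] := @args_swap n p x y s; first by rewrite size_cat.
  by rewrite [RHS](congr1 -%R (P3 t _)) t1 expr1 mulN1r opprK.
Qed.

Definition skew n (P : fn n) := forall (t : 'S_n) a, P a = (-1) ^+ t * P (a \o t).

Lemma skew_ctr_fn n x (P : fn n.+1) : skew P -> skew (ctr_fn x P).
Proof.
move=> P3 t a; rewrite /ctr_fn (P3 (lift_perm ord0 ord0 t)) odd_lift_perm.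
congr (_ * P _); apply: arg_cons_eq => [|i] /=; first by rewrite lift_perm_id arg_cons0.
by rewrite lift_perm_lift arg_consS.
Qed.

(** A cycle on [n.+1] positions has sign [(-1) ^+ n]. This is the sign in the definition of [Delta],
    which therefore disappears once the extra argument is put first. *)
Lemma arg_rcons_arg_cons n (P : fn n.+1) a x : skew P ->
  P (arg_rcons a x) = (-1) ^+ n * P (arg_cons x a).
Proof.
move=> P3; rewrite (P3 (lift_perm ord0 ord_max 1%g)) odd_lift_perm odd_perm1 addbF /=.
rewrite signr_odd; congr (_ * P _); apply: arg_cons_eq => [|i] /=.
  by rewrite lift_perm_id /arg_rcons unlift_none.
by rewrite lift_perm_lift perm1 /arg_rcons liftK.
Qed.

Section Delta.
Variable pi : poisson_bracket S.

(** This closed form can be matched with the terms of [delta_fun] in which the first argument takes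
    part. *)
Lemma lie_evn x s n (P : fn n) : size s = n ->
  lie pi x (evn P) s =
  pi x (P (args n s)) - \sum_(j < n) P (upd (args n s) j (pi x s`_j)).
Proof.
elim: s n P => [|y s IH] n P; first by move=> n0; case: n / n0 P => P;
  rewrite big_ord0 subr0.
case: n P => // n P [sn]; rewrite /= ctr_evn IH// big_ord_recl /evn /= sn eqxx.
rewrite /ctr_fn -args_cons opprD addrA addrAC; congr (_ - _ - P _).
  apply: eq_bigr => j _; rewrite /ctr_fn; congr P; apply/esym/arg_cons_eq => //.
apply/esym/funext => i; rewrite args_cons /upd.
by case: (unliftP ord0 i) => [j ->|->]; rewrite ?arg_consS ?arg_cons0.
Qed.

Lemma sum_lift0 n (Q : pred 'I_n.+1) (G : 'I_n.+1 -> S) : Q ord0 = false ->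
  \sum_(j | Q j) G j = \sum_(j | Q (lift ord0 j)) G (lift ord0 j).
Proof. by move=> Q0; rewrite big_mkcond big_ord_recl Q0 /= add0r -big_mkcond. Qed.

Lemma args_inord n (s : seq S) k : (k < n.+1)%N -> args n.+1 s (inord k) = s`_k.
Proof. by move=> kn; rewrite /args inordK. Qed.

Lemma bumpSS j l : bump j.+1 l.+1 = (bump j l).+1.
Proof. by rewrite /bump ltnS addnS. Qed.

Lemma bump0l l : bump 0 l = l.+1.
Proof. by []. Qed.

Lemma bump_le j l : (bump j l <= l.+1)%N.
Proof. by rewrite /bump; case: (j <= l)%N; rewrite /= ?add1n ?add0n. Qed.

(** The terms of [delta_fun] involving index 0 make up the Lie derivative along the first argument;
    the others are minus the differential of the contraction. Skewness is needed because the two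
    sides place the bracket at different positions. *)
Lemma poisson_d_evn s n (P : fn n) : skew P -> size s = n.+1 ->
  poisson_d pi (evn P) s = delta_fun pi P (args n.+1 s).
Proof.
elim: s n P => [//|x s IH] n P P3 [sn].
rewrite /= lie_evn//; case: n P P3 sn => [|n] P P3 sn.
  rewrite ctr_evn0 poisson_d0 subr0 big_ord0 subr0 /delta_fun !big_ord1 /=.
  rewrite big_mkcond big_ord1 addr0 mul1r; by [].
rewrite ctr_evn (IH _ _ (skew_ctr_fn x P3) sn).
rewrite /delta_fun !(big_ord_recl n.+1) /= expr0 mul1r -!addrA.
congr (_ + _); rewrite opprD addrCA; congr (_ + (_ + _)).
- rewrite -sumrN; apply: eq_bigr => i _.
  rewrite /bump add1n exprS mulN1r mulNr /ctr_fn; congr (- (_ * pi _ (P _))).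
  apply/esym/arg_cons_eq => [|l] //; rewrite /args /=.
  by rewrite /bump /= !add1n ltnS addnS.
(* Pairs with i = 0: the Lie derivative leaves the bracket at position j, while [delta_fun] puts it
   first; the cycle between the two has sign [(-1) ^+ j]. *)
- rewrite [RHS]sum_lift0// -sumrN; apply: eq_bigr => j _.
  rewrite add0n lift0 exprS mulN1r mulNr; congr (- _).
  rewrite (P3 (lift_perm ord0 j 1%g)) odd_lift_perm odd_perm1 addbF /= signr_odd.
  congr (_ * P _); apply/funext => l /=; rewrite /upd.
  case: (unliftP ord0 l) => [l' ->|->]; last by rewrite lift_perm_id eqxx.
  rewrite lift_perm_lift perm1 [lift j _ == _]eq_sym (negPf (neq_lift _ _)) !lift0 /=
    bump0l bumpSS.
  by rewrite args_inord // !ltnS (leq_trans (bump_le _ _))// ltn_ord.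
rewrite -sumrN; apply: eq_bigr => i _; rewrite -sumrN [RHS]sum_lift0 //.
apply: eq_big => [j|j ij]; first by rewrite /= !bump0l ltnS.
rewrite !lift0 !bump0l addSn addnS !exprS !mulN1r opprK -mulrN; congr (_ * _).
have n0 : (0 < n)%N.
  by rewrite -ltnS; apply: leq_ltn_trans (ltn_ord j); apply: leq_ltn_trans ij.
(* Position 1. The contraction puts x before the bracket and [delta_fun] puts it after, so positions
   0 and 1 are exchanged. *)
pose o1 := lift ord0 (Ordinal n0); have o1E : o1 != ord0 by rewrite eq_sym neq_lift.
rewrite [RHS](P3 (tperm ord0 o1)) odd_tperm eq_sym o1E expr1 mulN1r.
congr (- P _); apply/esym/arg_cons_eq => [|l] /=.
  rewrite tpermL lift0 /=; have -> : bump j.+1 (bump i.+1 0) = 0%N by [].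
  by rewrite /args inordK.
have [->|lo] := eqVneq l (Ordinal n0); first by rewrite tpermR.
rewrite tpermD ?neq_lift ?(inj_eq lift_inj) 1?eq_sym// lift0 /=.
case: l lo => -[|l] ln lo /=; first by case/eqP: lo; apply/val_inj.
have ln2 : (bump j (bump i l) < n.+1)%N.
  by rewrite ltnS (leq_trans (bump_le _ _))// (leq_ltn_trans (bump_le _ _)).
by rewrite !bumpSS args_inord// args_inord.
Qed.

End Delta.
End MultiLinks.

(** * Direct sums and the total space *)

Section DirectSum.
Variables (K : fieldType) (A : nat -> lmodType K).
Implicit Types x y : dsum A.

Lemma dsum_ext x y : (forall n, dcomp x n = dcomp y n) -> x = y.
Proof. by move=> xy; apply/val_inj; apply: functional_extensionality_dep. Qed.

Lemma dcomp0 n : dcomp (0 : dsum A) n = 0. Proof. by []. Qed.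
Lemma dcompD x y n : dcomp (x + y) n = dcomp x n + dcomp y n. Proof. by []. Qed.
Lemma dcompN x n : dcomp (- x) n = - dcomp x n. Proof. by []. Qed.
Lemma dcompZ c x n : dcomp (c *: x) n = c *: dcomp x n. Proof. by []. Qed.

Lemma dcomp_sum I (r : seq I) (P : pred I) (G : I -> dsum A) n :
  dcomp (\sum_(i <- r | P i) G i) n = \sum_(i <- r | P i) dcomp (G i) n.
Proof. exact: (big_morph (fun x => dcomp x n)). Qed.

Lemma dcomp_dinj n (a : A n) : dcomp (dinj a) n = a.
Proof. exact: eqtype.dfwith_in. Qed.

Lemma dcomp_dinj_neq n (a : A n) m : m != n -> dcomp (dinj a) m = 0.
Proof. by move=> mn; apply: eqtype.dfwith_out; rewrite eq_sym. Qed.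

Lemma dinj0 n : dinj (0 : A n) = 0.
Proof.
apply: dsum_ext => m; have [->|mn] := eqVneq m n; first by rewrite dcomp_dinj.
by rewrite dcomp_dinj_neq.
Qed.

Lemma dsum_bounded x : exists N, forall n, (N <= n)%N -> dcomp x n = 0.
Proof. exact: (elimT (asboolP _) (valP x)). Qed.

Lemma dsum_sum x N : (forall n, (N <= n)%N -> dcomp x n = 0) ->
  x = \sum_(n < N) dinj (dcomp x n).
Proof.
move=> xN; apply: dsum_ext => m; rewrite dcomp_sum; have [mN|Nm] := ltnP m N.
  rewrite (bigD1 (Ordinal mN)) // (dcomp_dinj (n := m)) big1; first by rewrite /= addr0.
  by move=> i im; rewrite dcomp_dinj_neq// eq_sym.
by rewrite xN// big1// => i _; rewrite dcomp_dinj_neq// gtn_eqF// (leq_trans (ltn_ord i)).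
Qed.

Lemma dsum_fun_subproof (f : forall n, A n) (N : nat) :
  (fun n => if (n < N)%N then f n else 0 : A n) \in @dsum_pred K A.
Proof. by apply/asboolP; exists N => n; rewrite ltnNge => ->. Qed.
Definition dsum_trunc f N : dsum A := DSum (dsum_fun_subproof f N).

Lemma dsum_fun (f : forall n, A n) : (exists N, forall n, (N <= n)%N -> f n = 0) ->
  exists x : dsum A, forall n, dcomp x n = f n.
Proof.
case=> N fN; exists (dsum_trunc f N) => n; rewrite /dcomp /=.
by case: ltnP => // /fN.
Qed.

Lemma fsbig_bounded (V : nmodType) (G : nat -> V) N : (forall n, (N <= n)%N -> G n = 0) ->
  \sum_(n \in [set: nat]) G n = \sum_(n < N) G n.
Proof.
move=> GN; rewrite (fsbigE (iota 0 N)) ?iota_uniq//; last first.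
  by move=> i _; rewrite mem_iota /= add0n -leqNgt => /GN.
rewrite -(big_mkord xpredT) /index_iota subn0; apply: eq_bigl => i.
by apply/asboolP.
Qed.

Lemma dgrade_grading : is_grading (@dgrade K A).
Proof.
split.
- by move=> n m _; rewrite dcomp0.
- by move=> n c x y xn yn m mn; rewrite dcompD dcompZ xn// yn// scaler0 addr0.
- move=> x; have [N xN] := dsum_bounded x.
  exists [seq Posz n | n <- iota 0 N], (fun z => if z is Posz n then dinj (dcomp x n)
    else 0).
  split.
    case=> n m; last by rewrite dcomp0.
    by rewrite eqz_nat => /dcomp_dinj_neq ->.
  rewrite big_map {1}(dsum_sum xN) -(big_mkord xpredT (fun n => dinj (dcomp x n))).
  by rewrite /index_iota subn0.
- move=> s f us fgr f0 z zs; apply: dsum_ext => m; rewrite dcomp0.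
  have [mz|mz] := eqVneq m%:Z z; last by rewrite fgr.
  have := congr1 (fun x => dcomp x m) f0; rewrite dcomp_sum dcomp0 (bigD1_seq z)//=.
  rewrite big1 ?addr0// => w wz; apply: fgr; rewrite mz eq_sym; exact: wz.
Qed.

End DirectSum.

Section TotalEval.
Variables (K : fieldType) (S : comAlgType K).
Local Notation T := (seq S -> S).
Local Notation comp x n := (dcomp x n : multider S n).
Implicit Types x y : multiders S.

Definition ev x : T := fun s => comp x (size s) (args (size s) s).

Lemma evE x n s : size s = n -> ev x s = comp x n (args n s).
Proof. by move=> <-. Qed.

Lemma ev_evn x n s : size s = n -> ev x s = evn (comp x n) s.
Proof. by move=> sn; rewrite /evn sn eqxx; apply: evE. Qed.

Lemma args_codom n (a : 'I_n -> S) : args n [seq a i | i <- enum 'I_n] = a.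
Proof.
apply/funext => i; rewrite /args (nth_map i) ?size_enum_ord//.
by congr a; apply/val_inj; rewrite /= nth_enum_ord.
Qed.

Lemma ev_inj : injective ev.
Proof.
move=> x y xy; apply: dsum_ext => n; apply/val_inj/funext => a.
have sn : size [seq a i | i <- enum 'I_n] = n by rewrite size_map size_enum_ord.
have := congr1 (fun f => f [seq a i | i <- enum 'I_n]) xy.
by rewrite !(evE _ sn) args_codom.
Qed.

Lemma evD x y : ev (x + y) = ev x + ev y. Proof. by []. Qed.
Lemma evN x : ev (- x) = - ev x. Proof. by []. Qed.
Lemma evZ c x : ev (c *: x) = fun s => c *: ev x s. Proof. by []. Qed.

Lemma ev_sum I (r : seq I) (P : pred I) (G : I -> multiders S) :
  ev (\sum_(i <- r | P i) G i) = \sum_(i <- r | P i) ev (G i).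
Proof. exact: (big_morph ev). Qed.

Lemma ev_dinj n (P : multider S n) :
  ev (dinj (A := multider_mod S) P) = evn P.
Proof.
apply/funext => s; rewrite /evn; case: eqP => [sn|/eqP sn].
  by rewrite (evE _ sn) dcomp_dinj.
by rewrite /ev dcomp_dinj_neq.
Qed.

Lemma multi_ev x : multi (ev x).
Proof.
have H n : multi (evn (comp x n)) by apply: multi_evn; apply: multiderP.
split=> p.
- move=> c a b s; have E z : ev x (p ++ z :: s) =
      evn (comp x (size p + (size s).+1)) (p ++ z :: s) by apply: ev_evn; rewrite size_cat.
  by rewrite !E; apply: multi_lin.
- move=> a b s; have E z : ev x (p ++ z :: s) =
      evn (comp x (size p + (size s).+1)) (p ++ z :: s) by apply: ev_evn; rewrite size_cat.
  by rewrite !E; apply: multi_der.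
- move=> a b s; have E z t : ev x (p ++ z :: t :: s) =
      evn (comp x (size p + (size s).+2)) (p ++ z :: t :: s) by apply: ev_evn;
        rewrite size_cat.
  by rewrite !E; apply: multi_swap.
Qed.

Lemma wdg_suml I (r : seq I) (G : I -> T) f s :
  wdg (\sum_(i <- r) G i) f s = \sum_(i <- r) wdg (G i) f s.
Proof.
elim: r => [|i r IH]; first by rewrite !big_nil wdg0l.
by rewrite !big_cons wdgDl IH.
Qed.

Lemma wdg_sumr I (r : seq I) (G : I -> T) f s :
  wdg f (\sum_(i <- r) G i) s = \sum_(i <- r) wdg f (G i) s.
Proof.
elim: r => [|i r IH]; first by rewrite !big_nil wdg0r.
by rewrite !big_cons wdgDr IH.
Qed.

Lemma fun_sumE I (r : seq I) (G : I -> T) s :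
  (\sum_(i <- r) G i) s = \sum_(i <- r) G i s.
Proof. exact: (big_morph (fun f : T => f s)). Qed.

Lemma wedge0l m n (Q : multider S n) : wedge (0 : multider S m) Q = 0.
Proof.
by apply/val_inj/funext => a; rewrite /= /wedge_fun big1// => t _; rewrite mulr0 mul0r.
Qed.

Lemma wedge0r m n (P : multider S m) : wedge P (0 : multider S n) = 0.
Proof.
by apply/val_inj/funext => a; rewrite /= /wedge_fun big1// => t _; rewrite mulr0.
Qed.

Lemma ev_total_wedge x y : ev (total_wedge x y) = wdg (ev x) (ev y).
Proof.
have [M xM] := dsum_bounded x; have [N yN] := dsum_bounded y.
have -> : total_wedge x y = \sum_(m < M) \sum_(n < N)
    dinj (A := multider_mod S) (wedge (comp x m) (comp y n)).
  rewrite /total_wedge (fsbig_bounded (N := M)) => [|m Mm].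
    by apply: eq_bigr => m _; apply: fsbig_bounded => n Nn; rewrite yN// wedge0r dinj0.
  rewrite (fsbig_bounded (N := 0)) ?big_ord0// => n _.
  by rewrite xM// wedge0l dinj0.
apply/funext => s; rewrite [in RHS](dsum_sum xM) [in RHS](dsum_sum yN) !ev_sum.
rewrite wdg_suml fun_sumE; apply: eq_bigr => m _.
rewrite ev_sum wdg_sumr fun_sumE; apply: eq_bigr => n _.
by rewrite !ev_dinj wdg_evn.
Qed.

Variable F : frobenius_iso S.

Lemma Delta0 n : Delta F (0 : multider S n.+1) = 0.
Proof.
apply/val_inj/funext => a; apply: (frob1_inj (F := F)) => z.
have E0 : frob_form F 0 1 = 0 by have := frob1Z F 0 0; rewrite scale0r mul0r.
have : frob_form F (Delta_fun F (0 : multider S n.+1) a) z = 0.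
  by rewrite Delta_funP; apply: etrans (congr1 _ E0) (mulr0 _).
rewrite frob_form1 mulrC => /= ->.
by apply/esym; rewrite -E0; congr (frob_form F); apply: mulr0.
Qed.

Lemma dcomp_total_Delta x n : dcomp (total_Delta F x) n = Delta F (comp x n.+1).
Proof.
have [N xN] := dsum_bounded x.
have xN' k : (N <= k)%N -> dinj (A := multider_mod S) (Delta F (comp x k.+1)) = 0.
  by move=> Nk; rewrite xN ?Delta0 ?dinj0// leqW.
rewrite /total_Delta (fsbig_bounded xN') dcomp_sum; have [nN|Nn] := ltnP n N.
  rewrite (bigD1 (Ordinal nN)) // (dcomp_dinj (n := n)) big1; first by rewrite /= addr0.
  by move=> i im; rewrite dcomp_dinj_neq// eq_sym.
rewrite xN ?Delta0 ?leqW// big1// => i _.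
by rewrite dcomp_dinj_neq// gtn_eqF// (leq_trans (ltn_ord i)).
Qed.

Lemma ev_total_Delta x : ev (total_Delta F x) = div F (ev x).
Proof.
apply/funext => s; apply/esym/divP; first exact/divergible_multi/multi_ev.
move=> z; rewrite {1}/ev dcomp_total_Delta mulrC -frob_form1.
rewrite (Delta_funP F (comp x (size s).+1)) arg_rcons_arg_cons; last first.
  by have [] := multiderP (comp x (size s).+1).
rewrite -args_cons -[comp x _ _]/(ev x (z :: s)).
(* The sign of [Delta], in K, cancels the one from moving the last argument to the front, in S; both
   are reduced to a parity. *)
rewrite -signr_odd -[in X in frob_form _ (X * _)]signr_odd; case: (odd _) => /=.
  by rewrite !mulN1r frob1N opprK.
by rewrite !mul1r.
Qed.

Lemma ev_one : ev (total_one S) = @unit_fun K S.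
Proof.
rewrite /total_one ev_dinj; apply/funext => -[|z s]; rewrite /evn //=.
Qed.


End TotalEval.

(** * A criterion for Batalin-Vilkovisky algebras *)

Section BVCriterion.
Variables (K : fieldType) (A : nat -> lmodType K).
Implicit Types (x y z : dsum A) (a b c : bool).

Definition dpar b x := forall n, odd n != b -> dcomp x n = 0.

Lemma dproj_subproof b x :
  (fun n => if odd n == b then dcomp x n else 0 : A n) \in @dsum_pred K A.
Proof.
by apply/asboolP; have [N xN] := dsum_bounded x; exists N => n /xN ->; case: ifP.
Qed.
Definition dproj b x : dsum A := DSum (dproj_subproof b x).
Definition deps x := dproj false x - dproj true x.

Lemma dcomp_dproj b x n : dcomp (dproj b x) n = if odd n == b then dcomp x n else 0.
Proof. by []. Qed.

Lemma dproj_lin b k x y : dproj b (k *: x + y) = k *: dproj b x + dproj b y.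
Proof.
apply: dsum_ext => n; rewrite dcompD dcompZ !dcomp_dproj dcompD dcompZ.
by case: ifP => // _; rewrite scaler0 addr0.
Qed.

Lemma dproj_par a b x : dpar a x -> dproj b x = if b == a then x else 0.
Proof.
move=> xa; apply: dsum_ext => n; rewrite dcomp_dproj.
have [->|na] := eqVneq (odd n) a; first by rewrite eq_sym; case: ifP.
by rewrite (xa n na); do 2!case: ifP => // _; rewrite (xa n na).
Qed.

Lemma deps_par a x : dpar a x -> deps x = (-1) ^+ a *: x.
Proof.
move=> xa; rewrite /deps !(dproj_par _ xa).
by case: a {xa}; rewrite /= ?sub0r ?subr0 ?scaleN1r ?scale1r.
Qed.

Lemma deps_lin k x y : deps (k *: x + y) = k *: deps x + deps y.
Proof. by rewrite /deps !dproj_lin scalerBr opprD addrACA. Qed.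

Lemma dcomp_deps x n : dcomp (deps x) n = (-1) ^+ n *: dcomp x n.
Proof.
rewrite dcompD dcompN !dcomp_dproj -signr_odd; case: (odd n) => /=.
  by rewrite sub0r scaleN1r.
by rewrite subr0 scale1r.
Qed.

Lemma dgrade_par (m : int) x : dgrade m x -> dpar (odd `|m|%N) x.
Proof.
by move=> xm n nm; apply: xm; apply: contraNneq nm => <-; rewrite absz_nat.
Qed.

Lemma sgzE (m : int) : (-1) ^ m = (-1) ^+ odd `|m|%N :> K.
Proof.
case: m => n; first by rewrite -exprnP signr_odd.
by rewrite NegzE -exprnN -exprVn invrN1 signr_odd abszN.
Qed.

Lemma odd_abszM (m n : int) : odd `|(m * n)%R|%N = odd `|m|%N && odd `|n|%N.
Proof. by rewrite abszM oddM. Qed.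

Lemma odd_abszD (m n : int) : odd `|(m + n)%R|%N = odd `|m|%N (+) odd `|n|%N.
Proof. lia. Qed.

Lemma odd_absz_pred (m : int) : odd `|(m - 1)%R|%N = ~~ odd `|m|%N.
Proof. by rewrite odd_abszD addbT. Qed.

Variables (mul : dsum A -> dsum A -> dsum A) (one : dsum A) (D : dsum A -> dsum A).

(** The failure of D to be a graded derivation. When [D one = 0], the last term in the formula
    defining the bracket drops out and this is the bracket up to sign. *)
Definition bv_deviator x y := D (mul x y) - mul (D x) y - mul (deps x) (D y).
Local Notation B := bv_deviator.

(* All signs are expressed through parities, with deps the grading involution,
   so that only the degree conditions mention integers. *)
Record bv_criterion : Prop := {
  bvc_bilinear : bilinear_op mul;
  bvc_assoc : associative mul;
  bvc_mul1l : left_id one mul;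
  bvc_mul1r : right_id one mul;
  bvc_one_gr : dgrade 0 one;
  bvc_mul_gr : forall m n x y, dgrade m x -> dgrade n y -> dgrade (m + n) (mul x y);
  bvc_comm : forall a b x y, dpar a x -> dpar b y ->
    mul x y = (-1) ^+ (a && b) *: mul y x;
  bvc_linear : forall k x y, D (k *: x + y) = k *: D x + D y;
  bvc_gr : forall m x, dgrade m x -> dgrade (m - 1) (D x);
  bvc_square : forall x, D (D x) = 0;
  bvc_one : D one = 0;
  bvc_leibniz : forall b c x y z, dpar b y -> dpar c z ->
    B (mul x y) z = (-1) ^+ (b && c) *: mul (B x z) y + mul (deps x) (B y z);
  bvc_jacobi : forall a b c x y z, dpar a x -> dpar b y -> dpar c z ->
    B (deps x) (B y z) = - B (B x y) z - (-1) ^+ (~~ a && b) *: B y (B x z)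
}.

Hypothesis C : bv_criterion.

Lemma bilinear_deviator : bilinear_op B.
Proof.
have [ml mr] := bvc_bilinear C; have Dl := bvc_linear C.
split=> k x y z; rewrite /bv_deviator.
  rewrite ml !Dl ml deps_lin ml !scalerBr !opprD.
  by rewrite [RHS]addrACA [X in _ = X + _]addrACA.
rewrite !(mr, Dl) !scalerBr !opprD.
by rewrite [RHS]addrACA [X in _ = X + _]addrACA.
Qed.

Section Bilinear.
Variable (f : dsum A -> dsum A -> dsum A).
Hypothesis fl : bilinear_op f.
Lemma bil_Dl x y z : f (x + y) z = f x z + f y z.
Proof. by have [h _] := fl; have := h 1 x y z; rewrite !scale1r. Qed.
Lemma bil_Dr x y z : f z (x + y) = f z x + f z y.
Proof. by have [_ h] := fl; have := h 1 x y z; rewrite !scale1r. Qed.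
Lemma bil_0l z : f 0 z = 0.
Proof. by apply: (addrI (f 0 z)); rewrite -bil_Dl addr0 [RHS]addr0. Qed.
Lemma bil_0r z : f z 0 = 0.
Proof. by apply: (addrI (f z 0)); rewrite -bil_Dr addr0 [RHS]addr0. Qed.
Lemma bil_Zl k x z : f (k *: x) z = k *: f x z.
Proof. by have [h _] := fl; have := h k x 0 z; rewrite !addr0 bil_0l addr0. Qed.
Lemma bil_Zr k x z : f z (k *: x) = k *: f z x.
Proof. by have [_ h] := fl; have := h k x 0 z; rewrite !addr0 bil_0r addr0. Qed.
Lemma bil_Nl x z : f (- x) z = - f x z.
Proof. by rewrite -scaleN1r bil_Zl scaleN1r. Qed.
Lemma bil_Nr x z : f z (- x) = - f z x.
Proof. by rewrite -scaleN1r bil_Zr scaleN1r. Qed.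
End Bilinear.

Lemma bvc_Z k x : D (k *: x) = k *: D x.
Proof.
have D0 : D 0 = 0.
  have := bvc_linear C 1 0 0; rewrite scaler0 addr0 scale1r => h.
  by apply: (addrI (D 0)); rewrite -h addr0.
by have := bvc_linear C k x 0; rewrite !addr0 D0 addr0.
Qed.

(* bv_brE gives the sign on elements of homogeneous parity. *)
Definition bv_br x y := - B x (dproj false y) + B (deps x) (dproj true y).

Lemma bv_brE a b x y : dpar a x -> dpar b y ->
  bv_br x y = (- (-1) ^+ (~~ a && b)) *: B x y.
Proof.
move=> xa yb; have Bb := bilinear_deviator.
rewrite /bv_br !(dproj_par _ yb) (deps_par xa); case: b {yb} => /=.
  rewrite (bil_0r Bb) oppr0 add0r (bil_Zl Bb) andbT; case: a {xa} => /=.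
    by rewrite expr0 expr1.
  by rewrite expr1 opprK.
by rewrite (bil_0r Bb) addr0 andbF expr0 scaleN1r.
Qed.

Lemma bilinear_br : bilinear_op bv_br.
Proof.
have [Bl Br] := bilinear_deviator; split=> k x y z; rewrite /bv_br.
  by rewrite deps_lin !Bl opprD -scalerN addrACA -scalerDr.
by rewrite !dproj_lin !Br opprD -scalerN addrACA -scalerDr.
Qed.

Lemma dgradeZ m k x : dgrade m x -> dgrade m (k *: x).
Proof. by move=> xm n nm; rewrite dcompZ xm// scaler0. Qed.
Lemma dgradeB m x y : dgrade m x -> dgrade m y -> dgrade m (x - y).
Proof. by move=> xm ym n nm; rewrite dcompD dcompN xm// ym// subr0. Qed.

Lemma dgrade_deviator m n x y : dgrade m x -> dgrade n y -> dgrade (m + n - 1) (B x y).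
Proof.
move=> xm yn; rewrite /bv_deviator; apply: dgradeB; first apply: dgradeB.
- by apply: (bvc_gr C); apply: (bvc_mul_gr C).
- by rewrite addrAC; apply: (bvc_mul_gr C) yn; apply: (bvc_gr C).
- rewrite (deps_par (dgrade_par xm)) -addrA.
  by apply: (bvc_mul_gr C); [apply: dgradeZ|apply: (bvc_gr C)].
Qed.

(** Graded commutativity passes from the product to the deviator; the sign in [bv_br] then turns
    this symmetry into the antisymmetry of the bracket. *)
Lemma deviatorC m n x y : dgrade m x -> dgrade n y ->
  B x y = (-1) ^+ (odd `|m|%N && odd `|n|%N) *: B y x.
Proof.
move=> xm yn; have px := dgrade_par xm; have py := dgrade_par yn.
have pdx := dgrade_par (bvc_gr C xm); have pdy := dgrade_par (bvc_gr C yn).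
rewrite odd_absz_pred in pdx; rewrite odd_absz_pred in pdy.
have mb := bvc_bilinear C.
rewrite /bv_deviator (deps_par px) (deps_par py) !(bil_Zl mb).
rewrite (bvc_comm C px py) bvc_Z (bvc_comm C pdx py) (bvc_comm C px pdy).
rewrite !scalerBr !scalerA addrAC; congr (_ *: _ - _ *: _ - _ *: _).
  by case: (odd `|m|%N) (odd `|n|%N) => [] [] /=; ring.
by case: (odd `|m|%N) (odd `|n|%N) => [] [] /=; ring.
Qed.

(** On homogeneous elements the bracket is a sign times the deviator, so the antisymmetry, Jacobi
    and Leibniz axioms reduce to finite checks of signs over parities. *)
Theorem bv_criterion_BV : is_BV (@dgrade K A) mul one D.
Proof.
have [ml mr] := bvc_bilinear C; have mb := bvc_bilinear C.
have Bb := bilinear_deviator.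
have gca : is_graded_comm_algebra (@dgrade K A) mul one.
  split; try by case: C.
  - exact: dgrade_grading.
  - move=> m n x y xm yn; rewrite sgzE odd_abszM.
    exact: (bvc_comm C (dgrade_par xm) (dgrade_par yn)).
have parB m n x y : dgrade m x -> dgrade n y ->
    dpar (~~ (odd `|m|%N (+) odd `|n|%N)) (B x y).
  by move=> xm yn; rewrite -odd_abszD -odd_absz_pred; apply/dgrade_par/dgrade_deviator.
have parZ b k x : dpar b x -> dpar b (k *: x).
  by move=> xb n nb; rewrite dcompZ xb// scaler0.
split=> //; [exact: bvc_linear|exact: bvc_gr|exact: bvc_square|].
exists bv_br; split.
  move=> m n x y xm yn; rewrite (bvc_one C) (bil_0r mb) (bil_0l mb) scaler0 addr0.
  rewrite (bv_brE (dgrade_par xm) (dgrade_par yn)) !sgzE odd_abszM odd_absz_pred.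
  rewrite scalerA mulrN -scaleNr opprK -expr2 sqrr_sign scale1r /bv_deviator.
  by rewrite (deps_par (dgrade_par xm)) (bil_Zl mb).
split=> //.
- exact: bilinear_br.
- move=> m n x y xm yn; rewrite (bv_brE (dgrade_par xm) (dgrade_par yn)).
  by apply: dgradeZ; apply: dgrade_deviator.
- move=> m n x y xm yn; have px := dgrade_par xm; have py := dgrade_par yn.
  rewrite (bv_brE px py) (bv_brE py px) (deviatorC xm yn) sgzE odd_abszM !odd_absz_pred.
  rewrite !scalerA -scaleNr; congr (_ *: _).
  by case: (odd `|m|%N) (odd `|n|%N) => [] [] /=; ring.
- move=> m n p x y z xm yn zp.
  have px := dgrade_par xm; have py := dgrade_par yn; have pz := dgrade_par zp.
  rewrite !(bv_brE px py, bv_brE py pz, bv_brE px pz).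
  rewrite (bv_brE px (parZ _ _ _ (parB _ _ _ _ yn zp))).
  rewrite (bv_brE py (parZ _ _ _ (parB _ _ _ _ xm zp))).
  rewrite (bv_brE (parZ _ _ _ (parB _ _ _ _ xm yn)) pz).
  rewrite !(bil_Zl Bb) !(bil_Zr Bb) sgzE odd_abszM !odd_absz_pred !scalerA.
  have := bvc_jacobi C px py pz; rewrite (deps_par px) (bil_Zl Bb).
  (* Multiplying by the sign of x undoes the involution in the Jacobi condition of the criterion. *)
  move/(congr1 (fun u => (-1) ^+ odd `|m|%N *: u)).
  rewrite scalerA -expr2 sqrr_sign scale1r => ->.
  rewrite scalerBr scalerN !scalerA -!scaleNr scalerDr !scalerA.
  by congr (_ *: _ + _ *: _);
    case: (odd `|m|%N) (odd `|n|%N) (odd `|p|%N) => [] [] [] /=; ring.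
- move=> m n p x y z xm yn zp.
  have px := dgrade_par xm; have py := dgrade_par yn; have pz := dgrade_par zp.
  have pxy := dgrade_par (bvc_mul_gr C xm yn); rewrite odd_abszD in pxy.
  rewrite (bv_brE pxy pz) (bv_brE px pz) (bv_brE py pz).
  rewrite (bvc_leibniz C _ py pz) (deps_par px) !(bil_Zl mb) !(bil_Zr mb).
  rewrite sgzE odd_abszM !odd_absz_pred scalerDr !scalerA.
  by congr (_ *: _ + _ *: _);
    case: (odd `|m|%N) (odd `|n|%N) (odd `|p|%N) => [] [] [] /=; ring.
Qed.

End BVCriterion.

(** * Multiderivations *)

Section TotalBV.
Variables (K : fieldType) (S : comAlgType K) (F : frobenius_iso S).
Local Notation T := (seq S -> S).
Local Notation comp x n := (dcomp x n : multider S n).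
Implicit Types x y z : multiders S.

(* f is homogeneous of degree m. *)
Definition homz (m : int) (f : T) := forall s, (size s)%:Z != m -> f s = 0.

(** Degrees are integers so that contraction always lowers them by one: a function of degree -1 is
    simply zero. *)
Lemma homz_wdg m n f g : homz m f -> homz n g -> homz (m + n) (wdg f g).
Proof.
move=> fm gn s; elim: s m n f g fm gn => [|x s IH] m n f g fm gn /= smn.
  have [m0|m0] := eqVneq m 0; last by rewrite fm ?mul0r// eq_sym.
  by rewrite gn ?mulr0//; move: smn; rewrite m0 add0r.
rewrite (IH (m - 1) n) ?(IH m (n - 1)) ?addr0//; try lia.
- by move=> t tm; rewrite epsE fm ?mulr0.
- by move=> t tn; apply: gn => /=; lia.
- by move=> t tm; apply: fm => /=; lia.
Qed.

Lemma homz_ev m x : homz m (ev x) <-> dgrade m x.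
Proof.
split=> [xm n nm|xm s sm]; last by rewrite /ev xm.
apply/val_inj/funext => a.
have sn : size [seq a i | i <- enum 'I_n] = n by rewrite size_map size_enum_ord.
by have := xm [seq a i | i <- enum 'I_n]; rewrite (evE _ sn) sn args_codom; apply.
Qed.

Lemma par_ev b x : dpar b x -> par b (ev x).
Proof. by move=> xb s sb; rewrite /ev xb. Qed.

Lemma ev_deps x : ev (deps x) = eps (ev x).
Proof.
apply/funext => s; rewrite {1}/ev dcomp_deps epsE.
rewrite -[LHS]/((-1) ^+ size s *: ev x s) -signr_odd -[in RHS]signr_odd.
by case: (odd _); rewrite ?expr0 ?scale1r ?mul1r // expr1 scaleN1r mulN1r.
Qed.

(** It also shows that the bracket of two evaluated elements is again a multiderivation, which the
    recursion of [schouten] leaves hidden. *)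
Lemma ev_deviator x y :
  ev (bv_deviator (@total_wedge K S) (total_Delta F) x y) = schouten (ev x) (ev y).
Proof.
rewrite /bv_deviator !evD !evN ev_total_Delta !ev_total_wedge !ev_total_Delta ev_deps.
rewrite div_wdg; [|exact: multi_ev..].
by apply/funext => s; rewrite !funE; ring.
Qed.

Lemma total_Delta_lin k x y :
  total_Delta F (k *: x + y) = k *: total_Delta F x + total_Delta F y.
Proof.
have dx u : divergible (ev u) by apply/divergible_multi/multi_ev.
apply: ev_inj; rewrite ev_total_Delta [ev (_ + y)]evD divD// [ev (k *: x)]evZ divZ//.
by rewrite evD evZ !ev_total_Delta.
Qed.

Lemma total_wedge_bilinear : bilinear_op (@total_wedge K S).
Proof.
split=> k x y z; apply: ev_inj; apply/funext => s;
  rewrite !(ev_total_wedge, evD, evZ) funD.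
  rewrite (_ : (fun t => k *: ev x t) = fun t => k%:A * ev x t).
    by rewrite wdgDl wdgMl mulr_algl.
  by apply/funext => t; rewrite mulr_algl.
rewrite (_ : (fun t => k *: ev x t) = fun t => k%:A * ev x t).
  by rewrite wdgDr wdgMr mulr_algl.
by apply/funext => t; rewrite mulr_algl.
Qed.

Lemma scaler_signE (b : bool) (u : S) : (-1) ^+ b *: u = (-1) ^+ b * u.
Proof. by case: b; rewrite ?expr0 ?scale1r ?mul1r// expr1 scaleN1r mulN1r. Qed.

Lemma multiders_criterion :
  bv_criterion (@total_wedge K S) (total_one S) (total_Delta F).
Proof.
split.
- exact: total_wedge_bilinear.
- by move=> x y z; apply: ev_inj; rewrite !ev_total_wedge wdgA.
- by move=> x; apply: ev_inj; rewrite ev_total_wedge ev_one wdg1l.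
- by move=> x; apply: ev_inj; rewrite ev_total_wedge ev_one wdg1r.
- by apply/homz_ev; rewrite ev_one => -[].
- by move=> m n x y /homz_ev xm /homz_ev yn; apply/homz_ev; rewrite ev_total_wedge;
  apply: homz_wdg.
- move=> a b x y xa yb; apply: ev_inj; apply/funext => s; rewrite evZ !ev_total_wedge.
  by rewrite (wdgC _ (par_ev xa) (par_ev yb)) scaler_signE.
- exact: total_Delta_lin.
- move=> m x xm n nm; rewrite dcomp_total_Delta (xm n.+1) ?Delta0//.
  by move: nm; lia.
- by move=> x; apply: ev_inj; rewrite !ev_total_Delta div_div//; apply: multi_ev.
- apply: dsum_ext => n; rewrite dcomp_total_Delta dcomp_dinj_neq// Delta0.
  by [].
- move=> b c x y z yb zc; apply: ev_inj; apply/funext => s.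
  rewrite ev_deviator evD evZ funD !ev_total_wedge !ev_deviator scaler_signE ev_deps.
  by apply: schouten_leibniz; by [apply: par_ev|apply: multi_ev].
- move=> a b c x y z xa yb zc; apply: ev_inj; apply/funext => s.
  pose B := bv_deviator (@total_wedge K S) (total_Delta F).
  rewrite -[RHS]/(- ev (B (B x y) z) s - (-1) ^+ (~~ a && b) *: ev (B y (B x z)) s).
  rewrite !ev_deviator ev_deps scaler_signE.
  rewrite (schouten_jacobi s (par_ev xa) (par_ev yb) (par_ev zc)); try exact: multi_ev.
  congr (_ - _); rewrite (eps_parity (par_ev yb)).
  case: a b {xa yb} => [] [] /=; rewrite ?expr0 ?expr1 ?mul1r ?mulN1r//.
  (* Pulling out the sign requires the inner bracket to be [multi]; it is, being the evaluation of a
     deviator. *)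
  by rewrite -(ev_deviator x z) schoutenNl; [|exact: multi_ev].
Qed.

End TotalBV.

(** * Poisson cohomology *)

Section Cohomology.
Variables (K : fieldType) (S : comAlgType K) (pi : poisson_bracket S).
Local Notation T := (seq S -> S).
Local Notation comp x n := (dcomp x n : multider S n).
Implicit Types (x y z : multiders S) (h k : HP pi).

Lemma lie_local n (u : S) (f g : T) s : (forall t, size t = n -> f t = g t) ->
  size s = n -> lie pi u f s = lie pi u g s.
Proof.
elim: s n f g => [|y s IH] n f g fg /=; first by move=> n0; rewrite fg.
move=> sn; rewrite fg// (IH n.-1 (ctr y f) (ctr y g)) -?sn// => t tn.
by apply: fg; rewrite /= tn -sn.
Qed.

(** On lists of one length [ev x] agrees with the extension by zero of a single component; locality
    then lets [poisson_d_evn] compute the differential of [ev x]. *)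
Lemma poisson_d_local n (f g : T) s : (forall t, size t = n -> f t = g t) ->
  size s = n.+1 -> poisson_d pi f s = poisson_d pi g s.
Proof.
elim: s n f g => // x s IH n f g fg [sn] /=; rewrite (lie_local x fg sn).
congr (_ - _); case: n fg sn => [|n] fg sn; first by move/size0nil: sn => ->.
by apply: (IH n) => // t tn; apply: fg; rewrite /= tn.
Qed.

Lemma poisson_d_ev x n s : size s = n.+1 ->
  poisson_d pi (ev x) s = delta_fun pi (comp x n) (args n.+1 s).
Proof.
move=> sn; rewrite -(poisson_d_evn pi _ sn); last by have [] := multiderP (comp x n).
by apply: poisson_d_local sn => t; apply: ev_evn.
Qed.

Definition is_cocycle x := forall n, comp x n \in @cocycle_pred K S pi n.

Lemma is_cocycleP x : is_cocycle x <-> poisson_d pi (ev x) = 0.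
Proof.
split=> [xc|dx n].
  apply/funext => -[//|y s]; rewrite (poisson_d_ev x (n := size s))//.
  by rewrite (eqP (xc _)).
apply/eqP/funext => a; rewrite -[a]args_codom -poisson_d_ev ?dx//.
by rewrite size_map size_enum_ord.
Qed.

Lemma HPclass0 n : HPclass (0 : cocycle pi n) = 0.
Proof.
have := lpiD (@coboundary_pred K S pi n) 0 0; rewrite addr0 => h.
by apply: (addrI (HPclass (0 : cocycle pi n))); rewrite [RHS]addr0; exact: esym h.
Qed.

Lemma insubd_multider0 n : insubd (0 : cocycle pi n) (0 : multider S n) = 0.
Proof. by apply/val_inj; rewrite /= insubdK// rpred0. Qed.

Lemma HPcl_ex x : exists h, forall n,
  dcomp h n = HPclass (insubd (0 : cocycle pi n) (comp x n)).
Proof.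
apply: dsum_fun; have [N xN] := dsum_bounded x; exists N => n /xN ->.
by rewrite insubd_multider0 HPclass0.
Qed.
(* The total class of a cocycle; components that are not cocycles are sent to 0. *)
Definition HPcl x : HP pi := projT1 (cid (HPcl_ex x)).

Lemma dcomp_cl x n : dcomp (HPcl x) n = HPclass (insubd (0 : cocycle pi n) (comp x n)).
Proof. exact: (projT2 (cid (HPcl_ex x))). Qed.

Lemma HPcl0 x n : dcomp x n = 0 -> dcomp (HPcl x) n = 0.
Proof. by move=> xn; rewrite dcomp_cl xn insubd_multider0 HPclass0. Qed.

Lemma HPcl_HPinj n (P : cocycle pi n) :
  HPcl (dinj (A := multider_mod S) (P : multider S n)) = HPinj P.
Proof.
apply: dsum_ext => m; have [->|mn] := eqVneq m n.
  by rewrite dcomp_cl /HPinj !dcomp_dinj valKd.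
by rewrite /HPinj dcomp_dinj_neq// HPcl0// dcomp_dinj_neq.
Qed.

Lemma is_cocycle_dinj n (P : cocycle pi n) :
  is_cocycle (dinj (A := multider_mod S) (P : multider S n)).
Proof.
move=> m; have [->|mn] := eqVneq m n; first by rewrite dcomp_dinj; exact: valP.
by rewrite dcomp_dinj_neq// rpred0.
Qed.

Lemma is_cocycleZ c x : is_cocycle x -> is_cocycle (c *: x).
Proof. move=> xc n; rewrite -[X in X \in _]/(c *: comp x n).
exact: (rpredZ c (xc n)).
Qed.
Lemma is_cocycleD x y : is_cocycle x -> is_cocycle y -> is_cocycle (x + y).
Proof. by move=> xc yc n; apply: (rpredD (xc n) (yc n)). Qed.
Lemma is_cocycleN x : is_cocycle x -> is_cocycle (- x).
Proof. by move=> xc; rewrite -scaleN1r; apply: is_cocycleZ. Qed.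

Lemma HPcl_lin c x y : is_cocycle x -> is_cocycle y -> HPcl (c *: x + y) = c *: HPcl x
  + HPcl y.
Proof.
move=> xc yc; apply: dsum_ext => n; rewrite dcompD dcompZ !dcomp_cl.
have -> : insubd (0 : cocycle pi n) (comp (c *: x + y) n) =
    c *: insubd (0 : cocycle pi n) (comp x n) + insubd (0 : cocycle pi n) (comp y n).
  by apply/val_inj; rewrite [RHS]/= !insubdK//; exact: (is_cocycleD (is_cocycleZ c xc) yc).
by rewrite /HPclass lpiD lpiZ.
Qed.

Definition exact_cochain x := exists z, ev x = poisson_d pi (ev z).

Lemma exactP x : (forall n, is_coboundary pi (comp x n)) <-> exact_cochain x.
Proof.
split=> [xb|[z xz] n].
  (* Zero components get the zero primitive, so that the chosen family has finite support. *)
  have Qex n : exists Q : multider S n,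
      comp x n.+1 = delta_fun pi Q :> (_ -> _) /\ (dcomp x n.+1 = 0 -> Q = 0).
    have [x0|x0] := eqVneq (dcomp x n.+1) 0.
      by exists 0; split=> //; rewrite delta_fun0 x0.
    have [Q xQ] := xb n.+1; exists Q; split=> // x00.
    by rewrite x00 eqxx in x0.
  have [|z zQ] := dsum_fun (A := multider_mod S) (f := fun n => projT1 (cid (Qex n))).
    have [N xN] := dsum_bounded x; exists N => n Nn.
    by have [_ ->] := projT2 (cid (Qex n)); rewrite ?xN// leqW.
  exists z; apply/funext => -[|y s]; first by rewrite /ev (xb 0).
  rewrite (poisson_d_ev z (n := size s))// zQ.
  by have [<- _] := projT2 (cid (Qex (size s))).
have xE a : comp x n a = poisson_d pi (ev z) [seq a i | i <- enum 'I_n].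
  by rewrite -xz (evE _ (n := n)) ?args_codom// size_map size_enum_ord.
case: n xE => [|n] xE; first by apply/funext => a; rewrite xE;
  case: (enum _) (size_enum_ord 0).
exists (comp z n); apply/funext => a; rewrite xE (poisson_d_ev z (n := n)) ?args_codom//.
by rewrite size_map size_enum_ord.
Qed.

Lemma HPcl_eq x y : is_cocycle x -> is_cocycle y -> HPcl x = HPcl y <-> exact_cochain
  (x - y).
Proof.
move=> xc yc; rewrite -exactP.
have H n : dcomp (HPcl x) n = dcomp (HPcl y) n <-> is_coboundary pi (comp (x - y) n).
  rewrite !dcomp_cl /HPclass; apply: iff_trans (lpiP _ _ _) _.
  have E : cocycle_multider (insubd (0 : cocycle pi n) (comp x n)
      - insubd (0 : cocycle pi n) (comp y n)) = comp (x - y) n.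
    by rewrite [LHS]/= !insubdK.
  by split=> [/asboolP|] h; [rewrite -E|apply/asboolP; rewrite E].
split=> [xy n|h]; first by apply/H; rewrite xy.
by apply: dsum_ext => n; apply/H.
Qed.

(** By the last clause, a class of given degree or parity is represented by a cocycle of the same
    degree or parity. *)
Lemma HPcl_surj h : exists x,
  [/\ is_cocycle x, HPcl x = h & forall n, dcomp h n = 0 -> dcomp x n = 0].
Proof.
have Qex n : exists Q : cocycle pi n, HPclass Q = dcomp h n /\ (dcomp h n = 0 -> Q = 0).
  have [h0|h0] := eqVneq (dcomp h n) 0; first by exists 0; rewrite HPclass0 h0.
  have [Q hQ] := lpi_repr (dcomp h n); exists Q; split=> // h00.
  by rewrite h00 eqxx in h0.
pose Q n := projT1 (cid (Qex n)).
have [|x xQ] := dsum_fun (A := multider_mod S) (f := fun n => Q n : multider S n).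
  have [N hN] := dsum_bounded h; exists N => n Nn.
  by rewrite /Q; have [_ ->] := projT2 (cid (Qex n)); rewrite ?hN.
have xc : is_cocycle x by move=> n; rewrite xQ; exact: valP.
exists x; split=> // [|n hn].
  apply: dsum_ext => n; rewrite dcomp_cl xQ valKd /Q.
  by have [-> _] := projT2 (cid (Qex n)).
by rewrite xQ /Q; have [_ ->] := projT2 (cid (Qex n)).
Qed.

Definition HPrep h : multiders S := projT1 (cid (HPcl_surj h)).
Lemma is_cocycle_HPrep h : is_cocycle (HPrep h).
Proof. by have [] := projT2 (cid (HPcl_surj h)). Qed.
Lemma HPrepK h : HPcl (HPrep h) = h.
Proof. by have [] := projT2 (cid (HPcl_surj h)). Qed.
Hint Resolve is_cocycle_HPrep is_cocycleN is_cocycleD is_cocycleZ : core.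

Lemma is_cocycle_wedge x y : is_cocycle x -> is_cocycle y -> is_cocycle (total_wedge x y).
Proof.
move=> /is_cocycleP xc /is_cocycleP yc; apply/is_cocycleP;
  rewrite ev_total_wedge poisson_d_wdg xc yc.
by apply/funext => s; rewrite funD wdg0l wdg0r addr0.
Qed.

Lemma is_cocycle_one : is_cocycle (total_one S).
Proof.
move=> n; rewrite /total_one; have [->|n0] := eqVneq n 0%N.
  by rewrite dcomp_dinj; exact: one_cocycle_subproof.
by rewrite dcomp_dinj_neq// rpred0.
Qed.

Lemma exact_wedgel x y : exact_cochain x -> is_cocycle y -> exact_cochain (total_wedge x y).
Proof.
move=> [z xz] /is_cocycleP yc; exists (total_wedge z y).
rewrite !ev_total_wedge poisson_d_wdg -xz yc.
by apply/funext => s; rewrite funD wdg0r addr0.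
Qed.

Lemma exact_wedger x y : is_cocycle x -> exact_cochain y -> exact_cochain (total_wedge x y).
Proof.
(* The involution on x cancels the [eps] in the derivation rule, and the other term dies because x
   is a cocycle. *)
move=> /is_cocycleP xc [z yz]; exists (total_wedge (deps x) z).
rewrite !ev_total_wedge ev_deps poisson_d_wdg epsK poisson_d_eps xc -yz.
have e0 : eps (0 : T) = 0 by apply/funext => s; rewrite /eps mulr0.
by apply/funext => s; rewrite funD e0 oppr0 wdg0l add0r.
Qed.

Lemma exact_add x y : exact_cochain x -> exact_cochain y -> exact_cochain (x + y).
Proof.
by move=> [z xz] [t yt]; exists (z + t); rewrite !evD poisson_dD xz yt.
Qed.

(** Defined through chosen representatives; [HPmul_cl] shows that the choice is immaterial. *)
Definition HPmul h k : HP pi := HPcl (total_wedge (HPrep h) (HPrep k)).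

Lemma HPmul_cl x y : is_cocycle x -> is_cocycle y -> HPmul (HPcl x) (HPcl y) = HPcl
  (total_wedge x y).
Proof.
move=> xc yc; apply/HPcl_eq; [by apply: is_cocycle_wedge..|].
have wb := total_wedge_bilinear S.
(* Changing one factor at a time leaves products of a cocycle with an exact cochain. *)
have -> : total_wedge (HPrep (HPcl x)) (HPrep (HPcl y)) - total_wedge x y =
    total_wedge (HPrep (HPcl x) - x) (HPrep (HPcl y)) + total_wedge x (HPrep (HPcl y) - y).
  by rewrite (bil_Dl wb) (bil_Dr wb) (bil_Nl wb) (bil_Nr wb) addrA addrNK.
apply: exact_add; [apply: exact_wedgel|apply: exact_wedger] => //.
  by apply/HPcl_eq; rewrite ?HPrepK.
by apply/HPcl_eq; rewrite ?HPrepK.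
Qed.

Lemma HPinj_mul : induced_by_wedge HPmul.
Proof.
move=> m n P Q.
have E : total_wedge (dinj (A := multider_mod S) (P : multider S m))
    (dinj (A := multider_mod S) (Q : multider S n)) =
    dinj (A := multider_mod S) (wedge P Q).
  by apply: ev_inj; rewrite ev_total_wedge !ev_dinj wdg_evn.
have Rc : wedge P Q \in @cocycle_pred K S pi (m + n).
  have := is_cocycle_wedge (is_cocycle_dinj P) (is_cocycle_dinj Q) (m + n).
  by rewrite E dcomp_dinj.
exists (Cocycle Rc) => //.
by rewrite -!HPcl_HPinj (HPmul_cl (is_cocycle_dinj _) (is_cocycle_dinj _)) E.
Qed.

(** * The divergence on the cohomology of a unimodular algebra *)

Variable F : frobenius_iso S.
Hypothesis uni : unimodular F pi.
Local Notation Delta := (total_Delta F).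

Lemma unimodular_frob (u v : S) : frob_form F (pi u v) 1 = 0.
Proof.
have := Delta_funP F (pb_multider pi) (fun=> u) v.
have -> : Delta_fun F (pb_multider pi) (fun=> u) = 0.
  exact: (congr1 (fun P : multider S 1 => P (fun=> u)) uni).
have -> : frob_form F 0 v = 0 by have := frob_formZl F 0 0 v; rewrite scale0r mul0r.
rewrite expr1 mulN1r /= /pb_fun.
have -> : arg_rcons (n := 1) (fun=> u) v ord0 = u.
  by rewrite /arg_rcons; have [j _ ->] := unlift_some (isT : ord_max != ord0 :> 'I_2).
have -> : arg_rcons (n := 1) (fun=> u) v ord_max = v by rewrite /arg_rcons unlift_none.
by move/esym/eqP; rewrite oppr_eq0 => /eqP.
Qed.

Lemma poisson_d_Delta x :
  poisson_d pi (ev (Delta x)) = - div F (poisson_d pi (ev x)).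
Proof.
by rewrite ev_total_Delta (div_poisson_d unimodular_frob) ?opprK//; apply: multi_ev.
Qed.

Lemma div0 : div F (0 : T) = 0.
Proof.
apply/funext => s; apply: divP => [|u]; last by rewrite mulr0.
by apply: divergible_multi; rewrite -[0 : T]/(ev (0 : multiders S)); apply: multi_ev.
Qed.

Lemma is_cocycle_Delta x : is_cocycle x -> is_cocycle (Delta x).
Proof. by move=> /is_cocycleP xc; apply/is_cocycleP;
  rewrite poisson_d_Delta xc div0 oppr0. Qed.

Lemma exact_Delta x : exact_cochain x -> exact_cochain (Delta x).
Proof.
move=> [z xz]; exists (- Delta z).
by rewrite evN poisson_dN poisson_d_Delta -xz opprK ev_total_Delta.
Qed.

Definition HPDelta h : HP pi := HPcl (Delta (HPrep h)).

Lemma HPDelta_cl x : is_cocycle x -> HPDelta (HPcl x) = HPcl (Delta x).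
Proof.
move=> xc; apply/HPcl_eq; [by apply: is_cocycle_Delta..|].
have -> : Delta (HPrep (HPcl x)) - Delta x = Delta (HPrep (HPcl x) - x).
  by rewrite addrC -scaleN1r -total_Delta_lin scaleN1r addrC.
by apply: exact_Delta; apply/HPcl_eq; rewrite ?HPrepK.
Qed.

Lemma HPclD x y : is_cocycle x -> is_cocycle y -> HPcl (x + y) = HPcl x + HPcl y.
Proof. by move=> xc yc; have := HPcl_lin 1 xc yc; rewrite !scale1r. Qed.
Lemma HPcl_0 : HPcl 0 = 0.
Proof. by apply: dsum_ext => n; rewrite HPcl0. Qed.
Lemma is_cocycle0 : is_cocycle 0.
Proof. by move=> n; exact: rpred0. Qed.
Lemma HPclZ c x : is_cocycle x -> HPcl (c *: x) = c *: HPcl x.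
Proof. by move=> xc; have := HPcl_lin c xc is_cocycle0; rewrite HPcl_0 !addr0. Qed.
Lemma HPclN x : is_cocycle x -> HPcl (- x) = - HPcl x.
Proof. by move=> xc; rewrite -scaleN1r HPclZ// scaleN1r. Qed.

Lemma HPinj_Delta : induced_by_Delta F HPDelta.
Proof.
split=> [P|n P]; rewrite -HPcl_HPinj HPDelta_cl; try exact: is_cocycle_dinj.
  rewrite -HPcl_0; congr HPcl; apply: dsum_ext => n.
  by rewrite dcomp_total_Delta dcomp_dinj_neq// Delta0.
have E : Delta (dinj (A := multider_mod S) (P : multider S n.+1)) =
    dinj (A := multider_mod S) (Defs.Delta F P).
  apply: dsum_ext => m; rewrite dcomp_total_Delta.
  have [->|mn] := eqVneq m n; first by rewrite !dcomp_dinj.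
  by rewrite !dcomp_dinj_neq// Delta0.
have Rc : Defs.Delta F P \in @cocycle_pred K S pi n.
  by have := is_cocycle_Delta (is_cocycle_dinj P) n; rewrite E dcomp_dinj.
by exists (Cocycle Rc) => //; rewrite E -HPcl_HPinj.
Qed.

Lemma is_cocycle_dproj b x : is_cocycle x -> is_cocycle (dproj b x).
Proof. by move=> xc n; rewrite dcomp_dproj; case: ifP => _; [exact: xc|exact: rpred0]. Qed.

Lemma is_cocycle_deps x : is_cocycle x -> is_cocycle (deps x).
Proof. by move=> xc; apply: is_cocycleD; [|apply: is_cocycleN];
  apply: is_cocycle_dproj. Qed.

Lemma HPcl_deps x : is_cocycle x -> deps (HPcl x) = HPcl (deps x).
Proof.
move=> xc; apply: dsum_ext => n; rewrite dcomp_deps.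
have E : dcomp (HPcl (deps x)) n = dcomp (HPcl ((-1) ^+ n *: x)) n.
  by rewrite !dcomp_cl dcomp_deps.
by rewrite E HPclZ.
Qed.

Hint Resolve is_cocycle_wedge is_cocycle_Delta is_cocycle_deps is_cocycle_one : core.
Local Notation B := (bv_deviator (@total_wedge K S) Delta).

Lemma is_cocycle_deviator x y : is_cocycle x -> is_cocycle y -> is_cocycle (B x y).
Proof. by rewrite /bv_deviator; auto 8. Qed.
Hint Resolve is_cocycle_deviator : core.

Lemma HPdeviator_cl x y : is_cocycle x -> is_cocycle y ->
  bv_deviator HPmul HPDelta (HPcl x) (HPcl y) = HPcl (B x y).
Proof.
move=> xc yc; have xyc := is_cocycle_wedge xc yc.
have dxc := is_cocycle_Delta xc; have dyc := is_cocycle_Delta yc;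
  have exc := is_cocycle_deps xc.
rewrite /bv_deviator (HPmul_cl xc yc) (HPDelta_cl xyc) (HPDelta_cl xc) (HPDelta_cl yc).
by rewrite (HPcl_deps xc) (HPmul_cl dxc yc) (HPmul_cl exc dyc) !HPclD ?HPclN; auto.
Qed.

Lemma HP_par a h : dpar a h -> exists x, [/\ is_cocycle x, HPcl x = h & dpar a x].
Proof.
by move=> ha; have [x [xc xh x0]] := HPcl_surj h; exists x; split=> // n /ha/x0.
Qed.

Lemma HP_grade m h : dgrade m h -> exists x, [/\ is_cocycle x, HPcl x = h & dgrade m x].
Proof.
by move=> hm; have [x [xc xh x0]] := HPcl_surj h; exists x; split=> // n /hm/x0.
Qed.

Lemma HPcl_grade m x : dgrade m x -> dgrade m (HPcl x).
Proof. by move=> xm n nm; rewrite HPcl0// xm. Qed.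

Lemma HPcl_one : HPcl (total_one S) = HP_one pi.
Proof. exact: (HPcl_HPinj (Cocycle (one_cocycle_subproof pi))). Qed.

Lemma HP_ex h : exists2 x, is_cocycle x & HPcl x = h.
Proof. by exists (HPrep h); [exact: is_cocycle_HPrep|exact: HPrepK]. Qed.

(** The operations in the criterion commute with taking classes of cocycles, so each condition is
    inherited from cocycle representatives, chosen with the prescribed degree or parity. *)
Lemma HP_criterion : bv_criterion HPmul (HP_one pi) HPDelta.
Proof.
have C := multiders_criterion F; have [wl wr] := bvc_bilinear C.
have w := is_cocycle_wedge; have d := is_cocycle_Delta; have o := is_cocycle_one.
split; rewrite -?HPcl_one.
- split=> c h k l; have [x xc <-] := HP_ex h; have [y yc <-] := HP_ex k;
    have [z zc <-] := HP_ex l; have xyc := is_cocycleD (is_cocycleZ c xc) yc;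
    rewrite -(HPcl_lin c xc yc).
    by rewrite (HPmul_cl xyc zc) (HPmul_cl xc zc) (HPmul_cl yc zc) wl HPcl_lin; auto.
  by rewrite (HPmul_cl zc xyc) (HPmul_cl zc xc) (HPmul_cl zc yc) wr HPcl_lin; auto.
- move=> h k l; have [x xc <-] := HP_ex h; have [y yc <-] := HP_ex k;
    have [z zc <-] := HP_ex l.
  rewrite (HPmul_cl yc zc) (HPmul_cl xc yc) (HPmul_cl xc (w _ _ yc zc)).
  by rewrite (HPmul_cl (w _ _ xc yc) zc) (bvc_assoc C).
- by move=> h; have [x xc <-] := HP_ex h; rewrite (HPmul_cl o xc) (bvc_mul1l C).
- by move=> h; have [x xc <-] := HP_ex h; rewrite (HPmul_cl xc o) (bvc_mul1r C).
- exact/HPcl_grade/(bvc_one_gr C).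
- move=> m n _ _ /HP_grade[x [xc <- xm]] /HP_grade[y [yc <- yn]].
  by rewrite (HPmul_cl xc yc); apply/HPcl_grade/(bvc_mul_gr C).
- move=> a b _ _ /HP_par[x [xc <- xa]] /HP_par[y [yc <- yb]].
  by rewrite (HPmul_cl xc yc) (HPmul_cl yc xc) (bvc_comm C xa yb) HPclZ; auto.
- move=> c h k; have [x xc <-] := HP_ex h; have [y yc <-] := HP_ex k.
  have xyc := is_cocycleD (is_cocycleZ c xc) yc; rewrite -(HPcl_lin c xc yc).
  rewrite (HPDelta_cl xyc) (HPDelta_cl xc) (HPDelta_cl yc) (bvc_linear C).
  by rewrite (HPcl_lin c (d _ xc) (d _ yc)).
- move=> m _ /HP_grade[x [xc <- xm]].
  by rewrite (HPDelta_cl xc); apply/HPcl_grade/(bvc_gr C).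
- move=> h; have [x xc <-] := HP_ex h.
  by rewrite (HPDelta_cl xc) (HPDelta_cl (d _ xc)) (bvc_square C) HPcl_0.
- by rewrite (HPDelta_cl o) (bvc_one C) HPcl_0.
- move=> b c h _ _ /HP_par[y [yc <- yb]] /HP_par[z [zc <- zc']].
  have [x xc <-] := HP_ex h; have xyc := w _ _ xc yc; have exc := is_cocycle_deps xc.
  have Bxz := is_cocycle_deviator xc zc; have Byz := is_cocycle_deviator yc zc.
  rewrite (HPmul_cl xc yc) (HPdeviator_cl xyc zc) (HPdeviator_cl xc zc).
  rewrite (HPdeviator_cl yc zc) (HPcl_deps xc) (HPmul_cl Bxz yc) (HPmul_cl exc Byz).
  by rewrite (bvc_leibniz C x yb zc') HPcl_lin; auto.
- move=> a b c _ _ _ /HP_par[x [xc <- xa]] /HP_par[y [yc <- yb]] /HP_par[z [zc <- zc']].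
  have exc := is_cocycle_deps xc; have Bxz := is_cocycle_deviator xc zc.
  have Bxy := is_cocycle_deviator xc yc; have Byz := is_cocycle_deviator yc zc.
  rewrite (HPcl_deps xc) (HPdeviator_cl yc zc) (HPdeviator_cl xc yc) (HPdeviator_cl xc zc).
  rewrite (HPdeviator_cl exc Byz) (HPdeviator_cl Bxy zc) (HPdeviator_cl yc Bxz).
  by rewrite (bvc_jacobi C xa yb zc') HPclD ?HPclN ?HPclZ; auto.
Qed.

End Cohomology.

Theorem theorem2 (K : fieldType) (S : comAlgType K)
    (pi : poisson_bracket S) (F : frobenius_iso S) :
  is_BV (@multiders_gr K S) (@total_wedge K S) (total_one S) (total_Delta F) /\
  (unimodular F pi ->
   exists (mul : HP pi -> HP pi -> HP pi) (D : HP pi -> HP pi),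
     [/\ induced_by_wedge mul,
         induced_by_Delta F D
       & is_BV (@HP_gr K S pi) mul (HP_one pi) D]).
Proof.
split=> [|uni]; first exact: bv_criterion_BV (multiders_criterion F).
exists (@HPmul K S pi), (@HPDelta K S pi F); split.
- exact: HPinj_mul.
- exact: HPinj_Delta.
- exact: bv_criterion_BV (HP_criterion uni).
Qed.
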